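(* Consider an $N$-bus power network and the parametrized AC optimal power flow problem with parameter $\xi^{\mathrm L}=(p^{\mathrm L},q^{\mathrm L})$ ranging over a nonempty open set $\Xi^{\mathrm L}\subseteq\mathbb{R}^{2N}$, $$\mathsf{P}(\xi^{\mathrm L}):\qquad \min_{x\in\mathbb{R}^{4N}} f(x)\quad\text{subject to}\quad \widetilde h(x,\xi^{\mathrm L})=0,\ \ h(x)=0,\ \ g(x)\le 0,$$ where $\widetilde h(x,\xi^{\mathrm L})=0$ are the AC power flow equations with fixed loads $\xi^{\mathrm L}$, and $h:\mathbb{R}^{4N}\to\mathbb{R}^I$, $g:\mathbb{R}^{4N}\to\mathbb{R}^J$ are the operational constraints (not depending on $\xi^{\mathrm L}$). Let $\mathcal{X}:=\{x\in\mathbb{R}^{4N}\mid h(x)=0,\ g(x)\le 0\}$. Assume that $g$ and $h$ are of class $C^r$ with $r>2N$ at all $x\in\mathcal{X}$, and that for all $x\in\mathcal{X}$ $$\operatorname{rank}\begin{bmatrix}\nabla h(x)\\ \nabla g_{\mathbf{J}(x)}(x)\end{bmatrix}=I+|\mathbf{J}(x)|,\qquad \mathbf{J}(x):=\{j\mid g_j(x)=0\}.$$ Then, for almost every load profile $\xi^{\mathrm L}\in\Xi^{\mathrm L}$, the linear independence constraint qualification (LICQ) for $\mathsf{P}(\xi^{\mathrm L})$ holds at every $x$ that is feasible for $\mathsf{P}(\xi^{\mathrm L})$.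
   Context: Power flow equations: the network has nodes $1,\dots,N$ and lines between some pairs of nodes; $\mathbf{N}(k)$ is the set of nodes connected to $k$ by a line. Node $k$ has complex voltage $u_k=v_ke^{j\theta_k}$ ($j=\sqrt{-1}$), fixed load $p^{\mathrm L}_k+jq^{\mathrm L}_k$, variable generation $p^{\mathrm G}_k+jq^{\mathrm G}_k$, and a fixed shunt admittance $y^{\mathrm{sh}}_k\in\mathbb{C}$. The line between $k$ and $l$ has series admittance $y_{kl}\in\mathbb{C}$ and shunt admittance $y^{\mathrm{sh}}_{kl}\in\mathbb{C}$. The nodal admittance matrix $Y\in\mathbb{C}^{N\times N}$ has entries $[Y]_{kk}=y^{\mathrm{sh}}_k+\sum_{i\in\mathbf{N}(k)}\left(y_{ki}+\tfrac12y^{\mathrm{sh}}_{ki}\right)$, $[Y]_{kl}=-y_{kl}$ for $l\in\mathbf{N}(k)$, and $0$ otherwise. With $x=(p^{\mathrm G},q^{\mathrm G},v,\theta)\in\mathbb{R}^{4N}$, the AC power flow equations are $$\widetilde h(x,\xi^{\mathrm L})=\begin{bmatrix}p^{\mathrm G}-p^{\mathrm L}-\operatorname{Re}\{\operatorname{diag}(u)(Yu)^*\}\\ q^{\mathrm G}-q^{\mathrm L}-\operatorname{Im}\{\operatorname{diag}(u)(Yu)^*\}\end{bmatrix}=0\in\mathbb{R}^{2N},$$ where $(\cdot)^*$ is the (entrywise) complex conjugate. The cost $f:\mathbb{R}^{4N}\to\mathbb{R}$ is continuously differentiable. Inequalities between vectors are componentwise; $\nabla$ is the Jacobian; $g_{\mathbf{J}(x)}$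 is the vector of the functions $g_j$, $j\in\mathbf{J}(x)$. ''Almost every'' means outside a set of Lebesgue measure zero in $\mathbb{R}^{2N}$. ''Of class $C^r$ at all $x\in\mathcal{X}$'' means $r$ times continuously differentiable on an open neighbourhood of $\mathcal{X}$. LICQ for $\mathsf{P}(\xi^{\mathrm L})$ at a feasible point $x$ means that the matrix obtained by stacking $\nabla_x\widetilde h(x,\xi^{\mathrm L})$, $\nabla h(x)$, $\nabla g_{\mathbf{J}(x)}(x)$ has rank $2N+I+|\mathbf{J}(x)|$. *)

(* Defs.v *)
From mathcomp Require Export all_boot all_order all_algebra.
From mathcomp Require Export all_classical all_reals all_analysis.
From mathcomp Require Export complex.

Set Implicit Arguments.
Unset Strict Implicit.
Unset Printing Implicit Defensive.

Import Order.TTheory GRing.Theory Num.Theory.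
Import numFieldNormedType.Exports.

Local Open Scope classical_set_scope.
Local Open Scope ring_scope.

(* [class_C k U f]: f is k times continuously differentiable on the (open)
   set U, i.e. all iterated partial derivatives up to order k exist and are
   continuous at every point of U. *)
Fixpoint class_C (R : realType) (n k : nat) (U : set 'rV[R]_n)
    (f : 'rV[R]_n -> R) : Prop :=
  (forall x, U x -> {for x, continuous f}) /\
  match k with
  | 0%N => True
  | k'.+1 => forall j : 'I_n,
      (forall x, U x -> derivable f x (delta_mx 0 j)) /\
      class_C k' U (fun x => 'D_(delta_mx 0 j) f x)
  end.

Definition class_C_at (R : realType) (n m k : nat) (X : set 'rV[R]_n)
    (F : 'rV[R]_n -> 'rV[R]_m) : Prop :=
  exists U : set 'rV[R]_n,
    [/\ open U, X `<=` U & forall i : 'I_m, class_C k U (fun x => F x 0 i)].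

(* The library's ['J F x] acts on row vectors from the right; its transpose is
   the m x n matrix whose i-th row is the gradient of the i-th component. *)
Definition jac (R : realType) (n m : nat) (F : 'rV[R]_n -> 'rV[R]_m)
    (x : 'rV[R]_n) : 'M[R]_(m, n) :=
  ('J F x)^T.

Definition box (R : realType) (n : nat) (a b : 'rV[R]_n) : set 'rV[R]_n :=
  [set x | forall i, a 0 i <= x 0 i <= b 0 i].

(* Covers are indexed by an arbitrary D : set nat, so finite covers (and the
   empty one) are included; this matters only when n = 0. *)
Definition lebesgue_outer (R : realType) (n : nat) (A : set 'rV[R]_n) : \bar R :=
  ereal_inf [set s | exists (D : set nat) (a b : nat -> 'rV[R]_n),
    [/\ forall k i, a k 0 i <= b k 0 i,
        A `<=` \bigcup_(k in D) box (a k) (b k) &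
        s = \esum_(k in D) (\prod_(i < n) (b k 0 i - a k 0 i))%:E]].

(* Sets of outer measure zero are exactly the Lebesgue measurable sets of measure
   zero (the Lebesgue sigma-algebra being complete). *)
Definition lebesgue_null (R : realType) (n : nat) (A : set 'rV[R]_n) : Prop :=
  lebesgue_outer A = 0%E.

Definition almost_every (R : realType) (n : nat) (D : set 'rV[R]_n)
    (Q : 'rV[R]_n -> Prop) : Prop :=
  lebesgue_null [set z | D z /\ ~ Q z].

(* Admittances of lines are functions of ordered pairs of nodes, only relevant
   at pairs joined by a line; they belong to the line, hence the symmetry. *)
Record power_network (R : realType) (N : nat) := PowerNetwork {
  line : rel 'I_N;
  line_sym : symmetric line;
  line_irr : irreflexive line;
  node_shunt : 'I_N -> R[i];
  series_adm : 'I_N -> 'I_N -> R[i];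
  series_adm_sym : forall k l, line k l -> series_adm k l = series_adm l k;
  line_shunt : 'I_N -> 'I_N -> R[i];
  line_shunt_sym : forall k l, line k l -> line_shunt k l = line_shunt l k
}.

Definition admittance (R : realType) (N : nat) (net : power_network R N)
    : 'M[R[i]]_N :=
  \matrix_(k, l)
    if k == l then
      node_shunt net k +
      \sum_(i | line net k i) (series_adm net k i + 2^-1 * line_shunt net k i)
    else if line net k l then - series_adm net k l else 0.

(* States x = (p^G, q^G, v, theta) and loads xi = (p^L, q^L). *)
Definition state (R : realType) (N : nat) := 'rV[R]_((N + N) + (N + N)).
Definition load (R : realType) (N : nat) := 'rV[R]_(N + N).

Definition gen_p (R : realType) (N : nat) (x : state R N) : 'rV[R]_N :=
  lsubmx (lsubmx x).
Definition gen_q (R : realType) (N : nat) (x : state R N) : 'rV[R]_N :=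
  rsubmx (lsubmx x).
Definition v_mag (R : realType) (N : nat) (x : state R N) : 'rV[R]_N :=
  lsubmx (rsubmx x).
Definition v_ang (R : realType) (N : nat) (x : state R N) : 'rV[R]_N :=
  rsubmx (rsubmx x).
Definition load_p (R : realType) (N : nat) (xi : load R N) : 'rV[R]_N :=
  lsubmx xi.
Definition load_q (R : realType) (N : nat) (xi : load R N) : 'rV[R]_N :=
  rsubmx xi.

Definition voltage (R : realType) (N : nat) (x : state R N) : 'cV[R[i]]_N :=
  \col_k (Complex (v_mag x 0 k) 0 *
          Complex (cos (v_ang x 0 k)) (sin (v_ang x 0 k))).

Definition power (R : realType) (N : nat) (net : power_network R N)
    (x : state R N) : 'cV[R[i]]_N :=
  let u := voltage x in
  diag_mx u^T *m map_mx conjc (admittance net *m u).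

Definition power_flow (R : realType) (N : nat) (net : power_network R N)
    (xi : load R N) (x : state R N) : 'rV[R]_(N + N) :=
  row_mx (gen_p x - load_p xi - (map_mx (@complex.Re R) (power net x))^T)
         (gen_q x - load_q xi - (map_mx (@complex.Im R) (power net x))^T).

(* The family of problems P(xi): minimize [cost x] subject to
   [power_flow net xi x = 0], [eqcon x = 0] and [ineqcon x <= 0]. *)
Record acopf (R : realType) (N I J : nat) := ACOPF {
  net : power_network R N;
  cost : state R N -> R;
  eqcon : state R N -> 'rV[R]_I;
  ineqcon : state R N -> 'rV[R]_J
}.

Definition operational (R : realType) (N I J : nat) (P : acopf R N I J)
    : set (state R N) :=
  [set x | eqcon P x = 0 /\ forall j, ineqcon P x 0 j <= 0].

Definition feasible (R : realType) (N I J : nat) (P : acopf R N I J)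
    (xi : load R N) : set (state R N) :=
  [set x | [/\ power_flow (net P) xi x = 0, eqcon P x = 0 &
               forall j, ineqcon P x 0 j <= 0]].

Definition active (R : realType) (N I J : nat) (P : acopf R N I J)
    (x : state R N) : {set 'I_J} :=
  [set j | ineqcon P x 0 j == 0]%SET.

Definition ineqcon_sub (R : realType) (N I J : nat) (P : acopf R N I J)
    (A : {set 'I_J}) (x : state R N) : 'rV[R]_#|A| :=
  \row_(i < #|A|) ineqcon P x 0 (enum_val i).

Definition operational_jac (R : realType) (N I J : nat) (P : acopf R N I J)
    (x : state R N) : 'M[R]_(I + #|active P x|, (N + N) + (N + N)) :=
  col_mx (jac (eqcon P) x) (jac (ineqcon_sub P (active P x)) x).

Definition LICQ (R : realType) (N I J : nat) (P : acopf R N I J)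
    (xi : load R N) (x : state R N) : Prop :=
  \rank (col_mx (jac (power_flow (net P) xi) x) (operational_jac P x))
    = (2 * N + I + #|active P x|)%N.

(* Main.v *)
(** The loads xi and the pair y = (v, theta) are coordinates on the set of
    states: the power flow equations define x from (xi, y) and become the
    projection (xi, y) |-> xi. In these coordinates, LICQ fails at x exactly
    when some combination of the gradients of the active operational
    constraints vanishes along y but not along xi, so the bad loads are the
    critical values of the projection restricted to the manifold of
    operational states with a given active set.

    Constraints with a nonzero derivative along y are used to eliminate
    variables y one at a time, by the implicit function theorem for one
    equation. Where all derivatives along y vanish, one more constraint
    eliminates one of the variables xi; what remains is a C^r map whose values
    lie in a space of dimension larger than the number of remaining xi
    variables and whose y-derivatives vanish on the set of interest. As in
    Morse's proof of Sard's theorem, either all functions vanishing on this set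
    have vanishing y-derivatives there, so that one more order of flatness is
    gained, or one of them eliminates another variable y. Once the y-derivatives
    are flat of order r - 1 >= dim y, the image is negligible by counting the
    cells of a grid of mesh 1/M along y and (1/M)^r along xi. *)

From HB Require Import structures.
Require Import Defs.
From mathcomp Require Import ring lra.

Set Implicit Arguments.
Unset Strict Implicit.
Unset Printing Implicit Defensive.

Import Order.TTheory GRing.Theory Num.Theory.
Import numFieldNormedType.Exports.

Local Open Scope classical_set_scope.
Local Open Scope ring_scope.

(** * Cubes and the mean value theorem *)

Definition pd (R : realType) (n : nat) (i : 'I_n) (f : 'rV[R]_n -> R) :
  'rV[R]_n -> R := fun x => 'D_(delta_mx 0 i) f x.

(** For [e > 0] this is the ball of the sup norm; the coordinatewise form lets one coordinate be
    inserted or deleted without changing the radius. *)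
Definition cube (R : realType) (n : nat) (x : 'rV[R]_n) (e : R) : set 'rV[R]_n :=
  [set y | forall i, `|y 0 i - x 0 i| < e].

Section cube.
Variables (R : realType) (n : nat).
Implicit Types (x y z : 'rV[R]_n) (e : R).

Lemma cube_ball x e : 0 < e -> cube x e = ball x e.
Proof.
move=> e0; apply/seteqP; split=> y /=.
  by move=> xy; split => // i j; rewrite ord1 /ball /= distrC.
by move=> [_ xy] i; have := xy 0 i; rewrite /ball /= distrC.
Qed.

Lemma nbhs_cubeP x (A : set 'rV[R]_n) :
  nbhs x A <-> exists2 e, 0 < e & cube x e `<=` A.
Proof.
split=> [/nbhs_ballP[e /= e0 eA]|[e e0 eA]].
  by exists e => //; rewrite cube_ball.
by apply/nbhs_ballP; exists e => //; rewrite -cube_ball.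
Qed.

Lemma nbhs_cube x e : 0 < e -> nbhs x (cube x e).
Proof. by move=> e0; apply/nbhs_cubeP; exists e. Qed.

Lemma open_cube x e : 0 < e -> open (cube x e).
Proof. by move=> e0; rewrite cube_ball//; exact: ball_open. Qed.

Lemma cube_center x e : 0 < e -> cube x e x.
Proof. by move=> e0 i; rewrite subrr normr0. Qed.

End cube.

(** The two difference quotients are the same function of h, so derivability along [v] suffices. *)
Lemma derive_line (R : realType) (V : normedModType R) (f : V -> R) (x v : V) (t : R) :
  derivable f (x + t *: v) v ->
  is_derive t 1 (fun s => f (x + s *: v)) ('D_v f (x + t *: v)).
Proof.
set g := fun s => _.
have E : (fun h : R => h^-1 *: ((g \o shift t) (h *: 1) - g t)) =
    (fun h : R => h^-1 *: ((f \o shift (x + t *: v)) (h *: v) - f (x + t *: v))).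
  apply/funext => h; rewrite /g /=; congr (_ *: (f _ - _)).
  by rewrite [_ *: 1]mulr1 scalerDl addrCA.
move=> df; apply: DeriveDef; first by rewrite /derivable E.
by rewrite /derive E.
Qed.

(** The usual mean value theorem is applied on [0, h] or [h, 0]; writing the intermediate point as
    [t * h] with t in [0, 1] covers both signs of [h] and [h = 0]. *)
Lemma mvt_line (R : realType) (V : normedModType R) (f : V -> R) (x v : V) (h : R) :
  (forall t, 0 <= t <= 1 -> derivable f (x + (t * h) *: v) v) ->
  exists2 t, 0 <= t <= 1 &
    f (x + h *: v) - f x = h * 'D_v f (x + (t * h) *: v).
Proof.
move=> df; pose g s := f (x + s *: v).
have dg s : (0 <= s <= h) || (h <= s <= 0) ->
    is_derive s 1 g ('D_v f (x + s *: v)).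
  have [-> s0|h0 s0] := eqVneq h 0.
    have {s0} -> : s = 0 by case/orP: s0 => /andP[? ?]; lra.
    by apply: derive_line; have := df 0; rewrite mul0r lexx ler01; apply.
  apply: derive_line; have := df (s / h); rewrite divfK//; apply.
  case/orP: s0 => /andP[sl sr].
    have h1 : 0 < h by lra.
    by rewrite (divr_ge0 sl (ltW h1)) ler_pdivrMr// mul1r.
  have h1 : h < 0 by lra.
  by rewrite ler_ndivlMr// mul0r sr ler_ndivrMr// mul1r.
have cg a b : (0 <= a /\ b <= h) \/ (h <= a /\ b <= 0) -> {within `[a, b], continuous g}.
  move=> ab; apply: derivable_within_continuous => s /[!in_itv]/= /andP[sa sb].
  by have [] := dg s; first by apply/orP; case: ab => -[? ?]; [left|right]; lra.
have [h0|h0] := leP 0 h.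
  have [|//|c] := @MVT_segment R g (fun s => 'D_v f (x + s *: v)) 0 h h0.
  - move=> s /[!in_itv]/= /andP[sa sb]; apply: dg; apply/orP; left; lra.
  - by apply: cg; left.
  rewrite in_itv/= => /andP[c0 ch]; rewrite /g scale0r addr0 => ->.
  have [->|hn0] := eqVneq h 0.
    by exists 0; [lra|rewrite subr0 !mul0r mulr0].
  have hp : 0 < h by rewrite lt_neqAle eq_sym hn0.
  exists (c / h); first by rewrite (divr_ge0 c0 h0) ler_pdivrMr// mul1r.
  by rewrite divfK// subr0 mulrC.
have [||c] := @MVT_segment R g (fun s => 'D_v f (x + s *: v)) h 0 (ltW h0).
- move=> s /[!in_itv]/= /andP[sa sb]; apply: dg; apply/orP; right; lra.
- by apply: cg; right.
rewrite in_itv/= => /andP[c0 ch]; rewrite /g scale0r addr0 => E.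
exists (c / h); first by rewrite ler_ndivlMr// mul0r ch ler_ndivrMr// mul1r.
rewrite divfK ?lt_eqF// -opprB E; lra.
Qed.

(** The path from x to y changes one coordinate at a time, and [mvt_line] applies to each edge. The
    points [p i] lie in the box spanned by x and y, but in general they differ from one another. *)
Lemma mvt_cube (R : realType) (n : nat) (f : 'rV[R]_n -> R) (x y : 'rV[R]_n) :
  (forall z : 'rV[R]_n, (forall k, exists2 t, 0 <= t <= 1 & z 0 k = x 0 k + t * (y 0 k - x 0 k)) ->
     forall i : 'I_n, derivable f z (delta_mx 0 i)) ->
  exists p : 'I_n -> 'rV[R]_n,
    (forall i k, exists2 t, 0 <= t <= 1 & p i 0 k = x 0 k + t * (y 0 k - x 0 k)) /\
    f y - f x = \sum_(i < n) (y 0 i - x 0 i) * pd i f (p i).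
Proof.
move=> df.
pose w m : 'rV[R]_n := \row_k (if (k < m)%N then y 0 k else x 0 k).
have w0 : w 0%N = x by apply/rowP => k; rewrite mxE ltn0.
have wn : w n = y by apply/rowP => k; rewrite mxE ltn_ord.
have wS (i : 'I_n) : w i.+1 = w i + (y 0 i - x 0 i) *: delta_mx 0 i.
  apply/rowP => k; rewrite !mxE eqxx/= ltnS leq_eqVlt.
  have [/val_inj ->|/=] := eqVneq (val k) (val i).
    by rewrite eqxx ltnn mulr1 addrC subrK.
  by rewrite -val_eqE/= => /negPf ->; rewrite mulr0 addr0.
have bt (i : 'I_n) t : 0 <= t <= 1 -> forall k, exists2 t', 0 <= t' <= 1 &
    (w i + (t * (y 0 i - x 0 i)) *: delta_mx 0 i) 0 k = x 0 k + t' * (y 0 k - x 0 k).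
  move=> t01 k; rewrite !mxE eqxx/=.
  have [->|ki] := eqVneq k i.
    by exists t => //; rewrite ltnn mulr1.
  rewrite mulr0 addr0.
  by case: ifP => _; [exists 1|exists 0]; rewrite ?lexx ?ler01// ?mul1r ?mul0r ?addr0// addrC subrK.
have /choice[p pP] : forall i : 'I_n, exists q : 'rV[R]_n,
    (forall k, exists2 t, 0 <= t <= 1 & q 0 k = x 0 k + t * (y 0 k - x 0 k)) /\
    f (w i.+1) - f (w i) = (y 0 i - x 0 i) * pd i f q.
  move=> i.
  have [t t01 E] := @mvt_line R _ f (w i) (delta_mx 0 i) (y 0 i - x 0 i)
    (fun t t01 => df _ (bt i t t01) i).
  by exists (w i + (t * (y 0 i - x 0 i)) *: delta_mx 0 i); split; [exact: bt|rewrite wS].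
exists p; split; first by move=> i; have [] := pP i.
rewrite -{1}wn -{1}w0 -(telescope_sumr (fun m => f (w m)) (leq0n n)) big_mkord.
by apply: eq_bigr => i _; have [] := pP i.
Qed.

Lemma ler_rV_norm (R : realType) (n : nat) (h : 'rV[R]_n) i : `|h 0 i| <= `|h|.
Proof.
rewrite [leRHS]/Num.Def.normr/= mx_normrE.
exact: (le_bigmax _ (fun ij => `|h ij.1 ij.2|) (0, i)).
Qed.

Lemma between_cube (R : realType) (n : nat) (x y z a : 'rV[R]_n) e :
  (forall k, exists2 t, 0 <= t <= 1 & z 0 k = x 0 k + t * (y 0 k - x 0 k)) ->
  cube a e x -> cube a e y -> cube a e z.
Proof.
move=> bt ax ay k; have [t /andP[t0 t1] ->] := bt k.
have := ax k; have := ay k; rewrite !ltr_norml => /andP[? ?] /andP[? ?].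
have [xy|/ltW xy] := leP (x 0 k) (y 0 k).
  have xy0 : 0 <= y 0 k - x 0 k by rewrite subr_ge0.
  have := mulr_ge0 t0 xy0; have := ler_piMl xy0 t1 => ? ?.
  by apply/andP; split; lra.
have xy0 : 0 <= x 0 k - y 0 k by rewrite subr_ge0.
have := mulr_ge0 t0 xy0; have := ler_piMl xy0 t1; rewrite !mulrBr => ? ?.
by apply/andP; split; lra.
Qed.

(** By [mvt_cube] the increment is a sum of partial derivatives at points near x, each multiplied by
    a coordinate of h; continuity of the partial derivatives at x bounds the remainder by a small
    multiple of [|h|]. *)
Lemma C1_differentiable (R : realType) (n : nat) (f : 'rV[R]_n -> R)
    (U : set 'rV[R]_n) (x : 'rV[R]_n) : nbhs x U ->
  (forall (i : 'I_n) z, U z -> derivable f z (delta_mx 0 i)) ->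
  (forall i, {for x, continuous (pd i f)}) ->
  differentiable f x.
Proof.
move=> xU df cf.
pose L (h : 'rV[R]_n) : R := \sum_(i < n) h 0 i * pd i f x.
have lin_L : linear L.
  move=> k u v; rewrite /L scaler_sumr -big_split/=; apply: eq_bigr => i _.
  by rewrite !mxE mulrDl -mulrA.
pose LM := GRing.isLinear.Build _ _ _ _ _ lin_L.
pose Ll : {linear _ -> _} := HB.pack L LM.
have cL : continuous Ll.
  move=> h; apply: differentiable_continuous.
  have -> : (Ll : 'rV[R]_n -> R) = \sum_(i < n) (fun h : 'rV[R]_n => h 0 i * pd i f x).
    by apply/funext => v; rewrite fct_sumE.
  apply: differentiable_sum => i; apply: differentiableM => //.
  exact: differentiable_coord.
have unique_L := @diff_unique R _ _ f Ll x cL.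
(* Typed by hand, the little-o premise of [unique_L] gets other structures. *)
suff H : ltac:(match type of unique_L with ?P -> _ => exact P end).
  by apply/diff_locallyP; rewrite (unique_L H); split.
apply/eqaddoP => e e0.
(* The n error terms, each at most [|h| * c], add up to less than [e * |h|] up to equality; the
   successor keeps the denominator nonzero when n = 0. *)
pose c : R := e / n.+1%:R.
have c0 : 0 < c by rewrite divr_gt0.
have Vx : \forall z \near x, forall i, `|pd i f x - pd i f z| < c.
  apply: (@filter_forall _ _ (fun (i : 'I_n) z => `|pd i f x - pd i f z| < c) (nbhs x) (@nbhs_filter _ x)) => i.
  by move: (cf i) => /cvgrPdist_lt; exact.
have /nbhs_cubeP[d d0 dV] := @filterI _ _ (@nbhs_filter _ x) _ _ xU Vx.
have : nbhs (0 : 'rV[R]_n) (cube 0 d) by exact: nbhs_cube.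
apply: filterS => h h0.
have xd : cube x d x by exact: cube_center.
have hd : cube x d (h + x) by move=> i; have := h0 i; rewrite !mxE subr0 addrK.
have bt (z : 'rV[R]_n) :
    (forall k, exists2 t, 0 <= t <= 1 & z 0 k = x 0 k + t * ((h + x) 0 k - x 0 k)) ->
    cube x d z.
  by move=> zz; exact: between_cube zz xd hd.
have [z /bt/dV[Uz _] i|p [pb E]] := @mvt_cube R n f x (h + x); first exact: df.
change (`|f (h + x) - (f x + L h)| <= e * `|h|).
have -> : f (h + x) - (f x + L h) = \sum_(i < n) h 0 i * (pd i f (p i) - pd i f x).
  rewrite opprD addrA E -sumrB; apply: eq_bigr => i _.
  by rewrite mxE addrK mulrBr.
apply: (le_trans (ler_norm_sum _ _ _)).
apply: (@le_trans _ _ (\sum_(i < n) `|h| * c)).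
  apply: ler_sum => i _; rewrite normrM ler_pM// ?ler_rV_norm//.
  by rewrite distrC ltW//; have /bt/dV[_] := pb i; apply.
rewrite sumr_const card_ord -mulr_natl /c.
have -> : n%:R * (`|h| * (e / n.+1%:R)) = (n%:R / n.+1%:R) * (e * `|h|) by ring.
rewrite ler_piMl ?mulr_ge0 ?(ltW e0)//.
by rewrite ler_pdivrMr// mul1r ler_nat.
Qed.

(** * Functions of class C^k *)

Section row_functions.
Variables (R : realType) (V : normedModType R) (p : nat).
Implicit Types (H : V -> 'rV[R]_p) (x : V).

Lemma row_fun_sum H :
  H = \sum_(i < p) (fun x => H x 0 i *: (delta_mx 0 i : 'rV[R]_p)).
Proof. by rewrite fct_sumE; apply/funext => x; exact: row_sum_delta. Qed.

Lemma differentiable_row H x :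
  (forall i, differentiable (fun x => H x 0 i) x) -> differentiable H x.
Proof.
by move=> dH; rewrite (row_fun_sum H); apply: differentiable_sum => i;
   exact: differentiableZl.
Qed.

Lemma continuous_row H x :
  (forall i, {for x, continuous (fun x => H x 0 i)}) -> {for x, continuous H}.
Proof.
move=> cH A /nbhs_cubeP[e e0 eA].
have : \forall z \near x, forall i, `|H x 0 i - H z 0 i| < e.
  apply: (@filter_forall _ _ (fun (i : 'I_p) z => `|H x 0 i - H z 0 i| < e)
    (nbhs x) (@nbhs_filter _ x)) => i.
  by move: (cH i) => /cvgrPdist_lt; exact.
by apply: filterS => z zx; apply: eA => i; rewrite distrC.
Qed.

Lemma derive_row H x v i : differentiable H x ->
  'D_v (fun x => H x 0 i) x = ('D_v H x) 0 i.
Proof. by move=> dH; rewrite derive_mx ?mxE//; exact: diff_derivable. Qed.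

End row_functions.

Section partial.
Variables (R : realType) (n : nat).
Implicit Types (f g : 'rV[R]_n -> R) (U : set 'rV[R]_n) (x v : 'rV[R]_n).

Lemma derive_sum_pd f x v : differentiable f x ->
  'D_v f x = \sum_(i < n) v 0 i * pd i f x.
Proof.
move=> df; rewrite deriveE// {1}[v]row_sum_delta linear_sum.
by apply: eq_bigr => i _; rewrite linearZ /pd deriveE.
Qed.

Lemma near_open U x (P : 'rV[R]_n -> Prop) : open U -> U x ->
  (forall z, U z -> P z) -> \forall z \near x, P z.
Proof. by move=> oU Ux UP; apply: (filterS UP); exact: open_nbhs_nbhs. Qed.

Lemma pd_ext U f g x i : open U -> U x -> (forall x, U x -> f x = g x) ->
  pd i f x = pd i g x.
Proof.
move=> oU Ux fg; apply: near_eq_derive.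
exact: (near_open oU Ux fg).
Qed.

Lemma derivable_ext U f g x v : open U -> U x -> (forall x, U x -> f x = g x) ->
  derivable f x v -> derivable g x v.
Proof.
move=> oU Ux fg; apply: near_eq_derivable.
exact: (near_open oU Ux fg).
Qed.

Lemma continuous_ext U f g x : open U -> U x -> (forall x, U x -> f x = g x) ->
  {for x, continuous f} -> {for x, continuous g}.
Proof.
move=> oU Ux fg cf; rewrite /prop_for /continuous_at -(fg _ Ux).
apply: cvg_trans cf; apply: (@near_eq_cvg _ _ _ (@nbhs_filter _ x)).
exact: (near_open oU Ux fg).
Qed.

End partial.

Lemma pd_comp (R : realType) n p (f : 'rV[R]_p -> R) (H : 'rV[R]_n -> 'rV[R]_p) x l :
  (forall i, differentiable (fun x => H x 0 i) x) -> differentiable f (H x) ->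
  pd l (f \o H) x = \sum_(i < p) pd i f (H x) * pd l (fun x => H x 0 i) x.
Proof.
move=> dHi df; have dH := differentiable_row dHi.
rewrite /pd deriveE; last exact: differentiable_comp.
rewrite diff_comp//= -(deriveE _ dH) -(deriveE _ df) derive_sum_pd//.
by apply: eq_bigr => i _; rewrite mulrC derive_row.
Qed.

Section class_C.
Variables (R : realType) (n : nat).
Implicit Types (f g : 'rV[R]_n -> R) (U : set 'rV[R]_n) (x v : 'rV[R]_n).

Lemma class_C_continuous k U f x : class_C k U f -> U x -> {for x, continuous f}.
Proof. by case: k => [[cf _]|k [cf _]]; exact: cf. Qed.

Lemma class_C_derivable k U f x (i : 'I_n) : class_C k.+1 U f -> U x ->
  derivable f x (delta_mx 0 i).
Proof. by move=> [_ /(_ i)[df _]]; exact: df. Qed.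

Lemma class_C_pd k U f i : class_C k.+1 U f -> class_C k U (pd i f).
Proof. by move=> [_ /(_ i)[]]. Qed.

Lemma class_C_sub k U U' f : U' `<=` U -> class_C k U f -> class_C k U' f.
Proof.
move=> U'U; elim: k f => [|k IH] f [cf df]; split=> //.
- by move=> x /U'U; exact: cf.
- by move=> x /U'U; exact: cf.
- by move=> i; have [dfi Cf] := df i; split; [move=> x /U'U; exact: dfi|exact: IH].
Qed.

(** Partial derivatives at a point of U depend only on values near it, hence on values in U as U is
    open. *)
Lemma class_C_ext k U f g : open U -> (forall x, U x -> f x = g x) ->
  class_C k U f -> class_C k U g.
Proof.
move=> oU; elim: k f g => [|k IH] f g fg [cf df]; split=> //.
- by move=> x Ux; apply: continuous_ext fg _ => //; exact: cf.
- by move=> x Ux; apply: continuous_ext fg _ => //; exact: cf.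
- move=> i; have [dfi Cf] := df i; split.
    by move=> x Ux; apply: derivable_ext fg _ => //; exact: dfi.
  by apply: IH Cf => x Ux; exact: (pd_ext _ oU Ux fg).
Qed.

Lemma class_CS k U f : class_C k.+1 U f -> class_C k U f.
Proof.
elim: k f => [|k IH] f [cf df]; split=> // i.
by have [dfi Cf] := df i; split=> //; exact: IH.
Qed.

Lemma class_C_le k k' U f : (k <= k')%N -> class_C k' U f -> class_C k U f.
Proof.
elim: k' => [|k' IH]; first by rewrite leqn0 => /eqP ->.
by rewrite leq_eqVlt ltnS => /predU1P[->//|kk'] /class_CS; exact: IH.
Qed.

Lemma class_C_differentiable k U f x : open U -> (0 < k)%N -> class_C k U f ->
  U x -> differentiable f x.
Proof.
move=> oU k0 /(class_C_le k0) Cf Ux; apply: (@C1_differentiable _ _ _ U).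
- exact: open_nbhs_nbhs.
- by move=> i z Uz; exact: class_C_derivable Cf Uz.
- by move=> i; apply: class_C_continuous (class_C_pd i Cf) Ux.
Qed.

Lemma class_C_cst k U (c : R) : class_C k U (fun=> c).
Proof.
elim: k c => [|k IH] c; (split; first by move=> x _; exact: cst_continuous) => // i.
split; first by move=> x _; exact: derivable_cst.
have -> : (fun x : 'rV[R]_n => 'D_(delta_mx 0 i) (fun=> c) x) = fun=> 0.
  by apply/funext => x; exact: derive_cst.
exact: IH.
Qed.

Lemma class_CD k U f g : open U -> class_C k U f -> class_C k U g ->
  class_C k U (fun x => f x + g x).
Proof.
move=> oU; elim: k f g => [|k IH] f g [cf df] [cg dg].
  by split=> // x Ux; apply: continuousD; [exact: cf|exact: cg].
split; first by move=> x Ux; apply: continuousD; [exact: cf|exact: cg].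
move=> i; have [dfi Cf] := df i; have [dgi Cg] := dg i; split.
  by move=> x Ux; apply: derivableD; [exact: dfi|exact: dgi].
apply: class_C_ext (IH _ _ Cf Cg) => // x Ux.
by rewrite -deriveD//; [exact: dfi|exact: dgi].
Qed.

Lemma class_CM k U f g : open U -> class_C k U f -> class_C k U g ->
  class_C k U (fun x => f x * g x).
Proof.
move=> oU; elim: k f g => [|k IH] f g Cf' Cg'; have [cf df] := Cf'; have [cg dg] := Cg'.
  by split=> // x Ux; apply: continuousM; [exact: cf|exact: cg].
split; first by move=> x Ux; apply: continuousM; [exact: cf|exact: cg].
move=> i; have [dfi Cf] := df i; have [dgi Cg] := dg i; split.
  by move=> x Ux; apply: derivableM; [exact: dfi|exact: dgi].
have := class_CD oU (IH _ _ (class_CS Cf') Cg) (IH _ _ (class_CS Cg') Cf).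
apply: class_C_ext => // x Ux.
by rewrite -[RHS]/('D__ (f * g) x) deriveM//; [exact: dfi|exact: dgi].
Qed.

Lemma class_CN k U f : open U -> class_C k U f -> class_C k U (fun x => - f x).
Proof.
move=> oU Cf; apply: class_C_ext (class_CM oU (class_C_cst k U (-1)) Cf) => // x _.
by rewrite mulN1r.
Qed.

Lemma class_C_sum k U (I : Type) (s : seq I) (F : I -> 'rV[R]_n -> R) :
  open U -> (forall i, class_C k U (F i)) -> class_C k U (fun x => \sum_(i <- s) F i x).
Proof.
move=> oU CF; elim: s => [|i s IH].
  apply: class_C_ext (class_C_cst k U 0) => // x _; by rewrite big_nil.
by apply: class_C_ext (class_CD oU (CF i) IH) => // x _; rewrite big_cons.
Qed.

Lemma class_CV k U f : open U -> (forall x, U x -> f x != 0) ->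
  class_C k U f -> class_C k U (fun x => (f x)^-1).
Proof.
move=> oU f0; elim: k => [|k IH] Cf.
  by split=> // x Ux; apply: continuousV; [exact: f0|exact: class_C_continuous Cf Ux].
have CV := IH (class_CS Cf); split.
  by move=> x Ux; apply: continuousV; [exact: f0|exact: class_C_continuous Cf Ux].
move=> i; split.
  by move=> x Ux; apply: derivableV; [exact: f0|exact: class_C_derivable Cf Ux].
have := class_CN oU (class_CM oU (class_CM oU CV CV) (class_C_pd i Cf)).
apply: class_C_ext => // x Ux.
rewrite [RHS]deriveV; [|exact: f0|exact: class_C_derivable Cf Ux].
by rewrite -exprVn expr2 scaleNr.
Qed.

Lemma class_C_coord k U (j : 'I_n) : class_C k U (fun x => x 0 j).
Proof.
case: k => [|k].
  by split=> // x _; apply: differentiable_continuous; exact: differentiable_coord.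
split; first by move=> x _; apply: differentiable_continuous; exact: differentiable_coord.
move=> i; split.
  by move=> x _; apply: diff_derivable; exact: differentiable_coord.
have -> : (fun x : 'rV[R]_n => 'D_(delta_mx 0 i) (fun x : 'rV[R]_n => x 0 j) x) =
    fun=> (delta_mx 0 i : 'rV[R]_n) 0 j.
  by apply/funext => x; rewrite (derive_row (H := id)) ?derive_id//.
exact: class_C_cst.
Qed.

End class_C.

(** By the chain rule each partial derivative of the composite is a sum of products of functions of
    one order less, to which the induction hypothesis applies. *)
Lemma class_C_comp (R : realType) n p k (U : set 'rV[R]_n) (W : set 'rV[R]_p)
    (f : 'rV[R]_p -> R) (H : 'rV[R]_n -> 'rV[R]_p) :
  open U -> open W -> (forall x, U x -> W (H x)) ->
  (forall i, class_C k U (fun x => H x 0 i)) -> class_C k W f ->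
  class_C k U (fun x => f (H x)).
Proof.
move=> oU oW UW; elim: k f => [|k IH] f CH Cf.
  split=> // x Ux; apply: continuous_comp.
    by apply: continuous_row => i; exact: class_C_continuous (CH i) Ux.
  by apply: class_C_continuous Cf _; exact: UW.
have dH x : U x -> forall i, differentiable (fun x => H x 0 i) x.
  by move=> Ux i; exact: class_C_differentiable (CH i) Ux.
have df x : U x -> differentiable f (H x).
  by move=> Ux; apply: class_C_differentiable Cf (UW _ Ux).
have dfH x : U x -> differentiable (f \o H) x.
  by move=> Ux; apply: differentiable_comp; [exact: differentiable_row (dH _ Ux)|exact: df].
split; first by move=> x Ux; exact: differentiable_continuous (dfH _ Ux).
move=> l; split; first by move=> x Ux; exact: diff_derivable (dfH _ Ux).
have CS : class_C k U (fun x => \sum_(i < p) pd i f (H x) * pd l (fun x => H x 0 i) x).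
  apply: class_C_sum => // i; apply: class_CM => //; last exact: class_C_pd (CH i).
  by apply: IH; [move=> j; exact: class_CS|exact: class_C_pd].
apply: class_C_ext CS => // x Ux.
by rewrite -pd_comp; [|exact: dH|exact: df].
Qed.

(** * Implicit functions *)

Lemma continuous_dist (R : realType) (T : topologicalType) (f : T -> R) x :
  (forall e, 0 < e -> \forall y \near x, `|f x - f y| < e) ->
  {for x, continuous f}.
Proof. by move=> H; apply/cvgrPdist_lt. Qed.

(** Inverse of the deletion [col' j]: the coordinates that remain after eliminating the j-th one are
    renumbered through [lift j]. *)
Definition ins (R : realType) (n : nat) (j : 'I_n.+1) (z : 'rV[R]_n) (a : R) : 'rV[R]_n.+1 :=
  \row_i if unlift j i is Some i' then z 0 i' else a.

Section ins.
Variables (R : realType) (n : nat) (j : 'I_n.+1).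
Implicit Types (z : 'rV[R]_n) (x : 'rV[R]_n.+1) (a : R).

Lemma ins_lift z a i : ins j z a 0 (lift j i) = z 0 i.
Proof. by rewrite mxE liftK. Qed.

Lemma ins_id z a : ins j z a 0 j = a.
Proof. by rewrite mxE unlift_none. Qed.

Lemma ins_col' x : ins j (col' j x) (x 0 j) = x.
Proof. by apply/rowP => i; rewrite mxE; case: unliftP => [i' ->|->//]; rewrite mxE. Qed.

Lemma insD z a h : ins j z (a + h) = ins j z a + h *: delta_mx 0 j.
Proof.
apply/rowP => i; rewrite !mxE eqxx/=; case: unliftP => [i' ->|->].
  by rewrite eq_sym (negPf (neq_lift _ _)) mulr0 addr0.
by rewrite eqxx mulr1.
Qed.

Lemma cube_ins x z a e : cube (col' j x) e z -> `|a - x 0 j| < e -> cube x e (ins j z a).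
Proof.
move=> xz xa i; case: (unliftP j i) => [i' ->|->]; last by rewrite ins_id.
by rewrite ins_lift; have := xz i'; rewrite mxE.
Qed.

Lemma cube_col' x y e : cube x e y -> cube (col' j x) e (col' j y).
Proof. by move=> xy i; rewrite !mxE. Qed.

Lemma class_C_ins k (V : set 'rV[R]_n) (psi : 'rV[R]_n -> R) i :
  class_C k V psi -> class_C k V (fun z => ins j z (psi z) 0 i).
Proof.
move=> Cpsi; case: (unliftP j i) => [i' ->|->].
  rewrite (_ : (fun z => _) = fun z => z 0 i'); first exact: class_C_coord.
  by apply/funext => z; rewrite ins_lift.
rewrite (_ : (fun z => _) = psi) //.
by apply/funext => z; rewrite ins_id.
Qed.

Lemma continuous_ins (psi : 'rV[R]_n -> R) z : {for z, continuous psi} ->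
  {for z, continuous (fun z => ins j z (psi z))}.
Proof.
(* [class_C 0] makes sense on any set, so continuity at z is regularity on the singleton. *)
move=> cpsi; apply: continuous_row => i; have : class_C 0 [set z] psi by split=> // x ->.
by move=> /(class_C_ins i)/class_C_continuous; apply.
Qed.

End ins.

Lemma pd_ins (R : realType) n (j : 'I_n.+1) (f : 'rV[R]_n.+1 -> R) psi z l :
  differentiable psi z -> differentiable f (ins j z (psi z)) ->
  pd l (fun z => f (ins j z (psi z))) z =
  pd (lift j l) f (ins j z (psi z)) + pd j f (ins j z (psi z)) * pd l psi z.
Proof.
move=> dpsi df.
have E1 i : (fun z => ins j z (psi z) 0 (lift j i)) = fun z => z 0 i.
  by apply/funext => y; rewrite ins_lift.
have E2 : (fun z => ins j z (psi z) 0 j) = psi.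
  by apply/funext => y; rewrite ins_id.
have dcoord i : differentiable (fun z : 'rV[R]_n => z 0 i) z.
  exact: differentiable_coord.
rewrite -[LHS]/(pd l (f \o (fun z => ins j z (psi z))) z) pd_comp//; last first.
  by move=> i; case: (unliftP j i) => [i' ->|->]; rewrite ?E1 ?E2.
rewrite (bigD1_ord j)//= E2 addrC; congr (_ + _).
rewrite (bigD1 l)//= big1 ?addr0 => [|i il]; rewrite E1 /pd (derive_row (H := id)) ?derive_id// mxE eqxx/=.
  by rewrite eqxx mulr1.
by rewrite (negPf il) mulr0.
Qed.

(** Where the j-th partial derivative is positive, g increases strictly in the j-th coordinate: the
    root [psi z] exists by the intermediate value theorem and is unique, and monotonicity makes it
    continuous. The mean value theorem then gives its partial derivatives, whose formula yields the
    regularity of [psi]. The last clause says that near x0 all zeros of g lie on the graph. *)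
Lemma implicit_function (R : realType) n k (U : set 'rV[R]_n.+1) g x0 j :
  open U -> U x0 -> class_C k.+1 U g -> g x0 = 0 -> pd j g x0 != 0 ->
  exists (V : set 'rV[R]_n.+1) (V' : set 'rV[R]_n) (psi : 'rV[R]_n -> R),
  [/\ nbhs x0 V, open V', class_C k.+1 V' psi,
      forall z, V' z -> [/\ U (ins j z (psi z)), g (ins j z (psi z)) = 0,
        pd j g (ins j z (psi z)) != 0 &
        forall l, pd l psi z =
          - (pd (lift j l) g (ins j z (psi z)) / pd j g (ins j z (psi z)))] &
      forall x, V x -> g x = 0 -> V' (col' j x) /\ x = ins j (col' j x) (psi (col' j x))].
Proof.
move=> oU Ux0; wlog g0 : g / 0 < pd j g x0.
  move=> wlg Cg gx0 pdg; case: (ltrgtP (pd j g x0) 0) => [gn|gp|g0]; last 2 first.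
  - exact: wlg.
  - by rewrite g0 eqxx in pdg.
  have pdN l x : U x -> pd l (fun x => - g x) x = - pd l g x.
    by move=> Ux; rewrite /pd deriveN//; exact: class_C_derivable Cg Ux.
  have [||||V [V' [psi [? ? ? H1 H2]]]] := wlg (fun x => - g x).
  - by rewrite pdN// oppr_gt0.
  - exact: class_CN.
  - by rewrite gx0 oppr0.
  - by rewrite pdN// oppr_eq0.
  exists V, V', psi; split=> //; last first.
    by move=> x Vx gx; apply: H2 => //; rewrite gx oppr0.
  move=> z /H1[Uz gz]; rewrite pdN// oppr_eq0 => pz H; split=> //.
    by apply: oppr_inj; rewrite gz oppr0.
  by move=> l; rewrite H pdN// invrN mulrNN.
move=> Cg gx0 _.
have [rho rho0 rhoP] : exists2 rho, 0 < rho & forall x, cube x0 rho x -> U x /\ 0 < pd j g x.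
  have /nbhs_cubeP[rho rho0 H] : nbhs x0 (U `&` [set x | 0 < pd j g x]).
    apply: (@filterI _ _ (@nbhs_filter _ x0)); first exact: open_nbhs_nbhs.
    have : {for x0, continuous (pd j g)}.
      exact: class_C_continuous (class_C_pd j Cg) Ux0.
    by move=> /cvgr_gt/(_ _ g0).
  by exists rho => // x /H.
have mono z a b : cube (col' j x0) rho z -> `|a - x0 0 j| < rho -> `|b - x0 0 j| < rho ->
    a < b -> g (ins j z a) < g (ins j z b).
  move=> zx ax bx ab.
  have H t : 0 <= t <= 1 -> cube x0 rho (ins j z a + (t * (b - a)) *: delta_mx 0 j).
    move=> t01; rewrite -insD; apply: cube_ins => //.
    (* The interval around [x0 0 j] is viewed as a cube of dimension 1, so that [between_cube] gives
       its convexity. *)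
    have : cube (x0 0 j)%:M rho (a + t * (b - a))%:M :> Prop.
      apply: (@between_cube _ 1 a%:M b%:M) => [i| i | i]; rewrite ?ord1 !mxE ?eqxx//=.
      by exists t.
    by move=> /(_ 0); rewrite !mxE.
  have [t t01] := @mvt_line R _ g (ins j z a) (delta_mx 0 j) (b - a)
     (fun t t01 => class_C_derivable Cg (rhoP _ (H t t01)).1).
  rewrite -insD (addrC a) subrK => E; rewrite -subr_gt0 E mulr_gt0 ?subr_gt0//.
  exact: (rhoP _ (H t t01)).2.
have gcont z a : U (ins j z a) -> {for z, continuous (fun z => g (ins j z a))}.
  move=> Uza; apply: continuous_comp; last exact: class_C_continuous Cg Uza.
  by apply: (@continuous_ins _ _ _ (fun=> a)); exact: cst_continuous.
(* Half of [rho] keeps both end points [x0 0 j - r] and [x0 0 j + r] strictly inside the region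
   where g is increasing. *)
pose r := rho / 2; have r0 : 0 < r by rewrite divr_gt0.
have rr : r < rho by rewrite /r; lra.
have xr e : -1 <= e <= 1 -> `|x0 0 j + e * r - x0 0 j| < rho.
  by move=> e1; rewrite addrC addKr ltr_norml; apply/andP; split; rewrite /r; nra.
have cx0 : cube (col' j x0) rho (col' j x0) by exact: cube_center.
have [d /andP[d0 dr] dP] : exists2 d, 0 < d <= rho & forall z, cube (col' j x0) d z ->
    g (ins j z (x0 0 j - r)) < 0 /\ 0 < g (ins j z (x0 0 j + r)).
  have gm : g (ins j (col' j x0) (x0 0 j - r)) < 0.
    rewrite -[ltRHS]gx0 -{3}(ins_col' j x0); apply: mono => //.
    - by have := xr (-1); rewrite mulN1r; apply; lra.
    - by rewrite subrr normr0.
    - by rewrite ltrBlDr ltrDl.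
  have gp : 0 < g (ins j (col' j x0) (x0 0 j + r)).
    rewrite -[ltLHS]gx0 -{1}(ins_col' j x0); apply: mono => //.
    - by rewrite subrr normr0.
    - by have := xr 1; rewrite mul1r; apply; lra.
    - by rewrite ltrDl.
  have H1 : nbhs (col' j x0) [set z | g (ins j z (x0 0 j - r)) < 0].
    have : {for col' j x0, continuous (fun z => g (ins j z (x0 0 j - r)))}.
      apply: gcont; apply: (rhoP _ _).1; apply: cube_ins => //.
      by have := xr (-1); rewrite mulN1r; apply; lra.
    by move=> /cvgr_lt/(_ _ gm).
  have H2 : nbhs (col' j x0) [set z | 0 < g (ins j z (x0 0 j + r))].
    have : {for col' j x0, continuous (fun z => g (ins j z (x0 0 j + r)))}.
      apply: gcont; apply: (rhoP _ _).1; apply: cube_ins => //.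
      by have := xr 1; rewrite mul1r; apply; lra.
    by move=> /cvgr_gt/(_ _ gp).
  have /nbhs_cubeP[d d0 dP] := @filterI _ _ (@nbhs_filter _ (col' j x0)) _ _ H1 H2.
  exists (Num.min d rho); first by rewrite lt_min d0 rho0 ge_min lexx orbT.
  by move=> z zd; apply: dP => i; apply: lt_le_trans (zd i) _; rewrite ge_min lexx.
pose V' := cube (col' j x0) d.
have V'rho z : V' z -> cube (col' j x0) rho z.
  by move=> zd i; apply: lt_le_trans (zd i) _.
have exist_root z : exists a, V' z -> `|a - x0 0 j| < rho /\ g (ins j z a) = 0.
  have [V'z|nV'] := pselect (V' z); last by exists 0.
  have [gm gp] := dP _ V'z.
  have [|||a a01 ga] := @IVT R (fun t => g (ins j z t)) (x0 0 j - r) (x0 0 j + r) 0.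
  - lra.
  - apply: derivable_within_continuous => t; rewrite in_itv/= => /andP[t1 t2].
    have E t' : ins j z t' = ins j z 0 + t' *: delta_mx 0 j by rewrite -insD add0r.
    rewrite (_ : (fun t => _) = fun t' => g (ins j z 0 + t' *: delta_mx 0 j)); last first.
      by apply/funext => t'; rewrite E.
    have Ut : U (ins j z t).
      apply: (rhoP _ _).1; apply: cube_ins; first exact: V'rho.
      by rewrite ltr_norml; apply/andP; split; lra.
    rewrite E in Ut; have gt := class_C_derivable (i := j) Cg Ut.
    by have [] := derive_line gt.
  - by rewrite ge_min (ltW gm) le_max (ltW gp) orbT.
  exists a => _; split=> //; move: a01; rewrite in_itv/= => /andP[? ?].
  by rewrite ltr_norml; apply/andP; split; lra.
have [psi psiP] := choice exist_root.
have psiU z : V' z -> cube x0 rho (ins j z (psi z)).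
  by move=> V'z; apply: cube_ins; [exact: V'rho|have [] := psiP z V'z].
(* By monotonicity the sign of g at height a tells on which side of the root a lies; continuity of
   [psi] follows, since these signs persist for nearby z. *)
have sign_lt z a : V' z -> `|a - x0 0 j| < rho -> g (ins j z a) < 0 -> a < psi z.
  move=> V'z xa ga; rewrite ltNge; apply/negP; rewrite le_eqVlt => /predU1P[pa|pa].
    by move: ga; rewrite -pa (psiP z V'z).2 ltxx.
  have := mono z _ _ (V'rho _ V'z) (psiP z V'z).1 xa pa.
  by rewrite (psiP z V'z).2 => /ltW; rewrite leNgt ga.
have sign_gt z a : V' z -> `|a - x0 0 j| < rho -> 0 < g (ins j z a) -> psi z < a.
  move=> V'z xa ga; rewrite ltNge; apply/negP; rewrite le_eqVlt => /predU1P[pa|pa].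
    by move: ga; rewrite pa (psiP z V'z).2 ltxx.
  have := mono z _ _ (V'rho _ V'z) xa (psiP z V'z).1 pa.
  by rewrite (psiP z V'z).2 => /ltW; rewrite leNgt ga.
have oV' : open V' by exact: open_cube.
have cpsi z : V' z -> {for z, continuous psi}.
  move=> V'z; apply: continuous_dist => e e0.
  have [xz gz] := psiP z V'z.
  (* Half the distance left to the boundary keeps [psi z - e'] and [psi z + e'] within [rho] of
     [x0 0 j]. *)
  pose e' := Num.min e ((rho - `|psi z - x0 0 j|) / 2).
  have e'0 : 0 < e' by rewrite lt_min e0 divr_gt0// subr_gt0.
  have e'e : e' <= e by rewrite ge_min lexx.
  have e'r : e' <= (rho - `|psi z - x0 0 j|) / 2 by rewrite ge_min lexx orbT.
  have xm : `|psi z - e' - x0 0 j| < rho.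
    have := ler_norm (psi z - x0 0 j); have := ler_norm (- (psi z - x0 0 j)).
    by rewrite normrN ltr_norml => ? ?; apply/andP; split; lra.
  have xp : `|psi z + e' - x0 0 j| < rho.
    have := ler_norm (psi z - x0 0 j); have := ler_norm (- (psi z - x0 0 j)).
    by rewrite normrN ltr_norml => ? ?; apply/andP; split; lra.
  have gm : g (ins j z (psi z - e')) < 0.
    by rewrite -gz; apply: mono => //; [exact: V'rho|rewrite ltrBlDr ltrDl].
  have gp : 0 < g (ins j z (psi z + e')).
    by rewrite -gz; apply: mono => //; [exact: V'rho|rewrite ltrDl].
  have Uz a : `|a - x0 0 j| < rho -> U (ins j z a).
    by move=> xa; apply: (rhoP _ _).1; apply: cube_ins => //; exact: V'rho.
  have H1 : nbhs z [set y | g (ins j y (psi z - e')) < 0].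
    by have := gcont _ _ (Uz _ xm); move=> /cvgr_lt/(_ _ gm).
  have H2 : nbhs z [set y | 0 < g (ins j y (psi z + e'))].
    by have := gcont _ _ (Uz _ xp); move=> /cvgr_gt/(_ _ gp).
  have H3 : nbhs z V' by exact: open_nbhs_nbhs.
  have H12 := @filterI _ _ (@nbhs_filter _ z) _ _ H1 H2.
  apply: (filterS _ (@filterI _ _ (@nbhs_filter _ z) _ _ H12 H3)).
  move=> y [[y1 y2] V'y].
  have := sign_lt y _ V'y xm y1; have := sign_gt y _ V'y xp y2 => ? ?.
  by rewrite ltr_norml; apply/andP; split; lra.
have dpsi z l : V' z -> is_derive z (delta_mx 0 l) psi
    (- (pd (lift j l) g (ins j z (psi z)) / pd j g (ins j z (psi z)))).
  move=> V'z; set y0 := ins j z (psi z); set D := - _.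
  have y0r : cube x0 rho y0 by exact: psiU.
  have [Uy0 gy0] := rhoP _ y0r.
  (* Two separate arguments are needed: [mvt_cube] evaluates the numerator and the denominator at
     different intermediate points, both tending to [y0]. *)
  pose Q (uv : 'rV[R]_n.+1 * 'rV[R]_n.+1) := - (pd (lift j l) g uv.1 * (pd j g uv.2)^-1).
  have cQ : {for (y0, y0), continuous Q}.
    apply: continuousN; apply: continuousM.
      apply: (@continuous_comp _ _ _ fst (pd (lift j l) g)); first exact: cvg_fst.
      exact: class_C_continuous (class_C_pd (lift j l) Cg) Uy0.
    apply: continuousV; first exact: lt0r_neq0.
    apply: (@continuous_comp _ _ _ snd (pd j g)); first exact: cvg_snd.
    exact: class_C_continuous (class_C_pd j Cg) Uy0.
  pose Y h := ins j (h *: delta_mx 0 l + z) (psi (h *: delta_mx 0 l + z)).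
  have Y0 : Y 0 = y0 by rewrite /Y scale0r add0r.
  have cY : {for (0 : R), continuous Y}.
    apply: (@continuous_comp _ _ _ (fun h : R => h *: delta_mx 0 l + z) (fun z => ins j z (psi z))).
      by apply: continuousD; [exact: scalel_continuous|exact: cst_continuous].
    by rewrite scale0r add0r; apply: continuous_ins; exact: cpsi.
  suff H : (fun h => h^-1 *: ((psi \o shift z) (h *: delta_mx 0 l) - psi z)) @ 0^' --> (D : R).
    by apply: DeriveDef; [apply: cvgP H|apply: cvg_lim H].
  apply/cvgrPdist_lt => e e0.
  have /cvgrPdist_lt/(_ _ e0)[[/= A B] [/= nA nB] ABQ] := cQ.
  have nC : nbhs y0 (cube x0 rho) by apply: open_nbhs_nbhs; split=> //; exact: open_cube.
  have nAB := @filterI _ _ (@nbhs_filter _ y0) _ _ nA nB.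
  have /nbhs_cubeP[dl dl0 dlP] := @filterI _ _ (@nbhs_filter _ y0) _ _ nAB nC.
  have nY : \forall h \near (0 : R), cube y0 dl (Y h).
    by apply: cY; rewrite Y0; exact: nbhs_cube.
  have nV : \forall h \near (0 : R), V' (h *: delta_mx 0 l + z).
    have c : {for (0 : R), continuous (fun h : R => h *: delta_mx 0 l + z)}.
      by apply: continuousD; [exact: scalel_continuous|exact: cst_continuous].
    by apply: c; rewrite scale0r add0r; exact: open_nbhs_nbhs.
  near=> h.
  have h0 : h != 0 by near: h; exact: nbhs_dnbhs_neq.
  have Yh : cube y0 dl (Y h) by near: h; exact: nbhs_dnbhs.
  have Vh : V' (h *: delta_mx 0 l + z) by near: h; exact: nbhs_dnbhs.
  have bt (y : 'rV[R]_n.+1) :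
      (forall k, exists2 t, 0 <= t <= 1 & y 0 k = y0 0 k + t * (Y h 0 k - y0 0 k)) ->
      cube y0 dl y.
    by move=> yb; apply: between_cube yb _ Yh; exact: cube_center.
  have [y /bt/dlP[_ yr] i|p [pb E]] := @mvt_cube R _ g y0 (Y h).
    exact: class_C_derivable Cg (rhoP _ yr).1.
  have [[Al _] _] := dlP _ (bt _ (pb (lift j l))).
  have [[_ Bj] jr] := dlP _ (bt _ (pb j)).
  have pj0 := lt0r_neq0 (rhoP _ jr).2.
  (* Since g vanishes at both ends and only the coordinates [j] and [lift j l] change, the mean
     value identity has two terms and can be solved for the increment of [psi]. *)
  have -> : h^-1 *: ((psi \o shift z) (h *: delta_mx 0 l) - psi z) = Q (p (lift j l), p j).
    move: E; rewrite (bigD1_ord j)//= (bigD1 l)//= big1 => [|i il]; last first.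
      by rewrite !ins_lift !mxE (negPf il) andbF mulr0 add0r subrr mul0r.
    rewrite !ins_lift !ins_id !mxE !eqxx/= mulr1 addrK (psiP _ Vh).2 (psiP _ V'z).2.
    rewrite subrr addr0 /Q/= => E.
    have -> : psi (h *: delta_mx 0 l + z) - psi z = - (h * pd (lift j l) g (p (lift j l)) / pd j g (p j)).
      by apply: (mulIf pj0); rewrite mulNr divfK//; apply/eqP; rewrite -addr_eq0 -E.
    by rewrite scalerN; congr (- _); rewrite -[LHS]/(h^-1 * _) -mulrA mulKf.
  have -> : D = Q (y0, y0) by [].
  by apply: (ABQ (_, _)).
(* Bootstrap: if [psi] is C^m with m at most k, the formula for its partial derivatives shows that
   these are C^m, so [psi] is C^(m+1). *)
have Cpsi m : (m <= k.+1)%N -> class_C m V' psi.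
  elim: m => [|m IH] mk; first by split.
  have {}IH := IH (ltnW mk).
  have CY f : class_C k U f -> class_C m V' (fun z => f (ins j z (psi z))).
    move=> Cf; apply: (class_C_comp (H := fun z => ins j z (psi z)) oV' oU).
    - by move=> z /psiU/rhoP[].
    - by move=> i; exact: class_C_ins.
    - exact: class_C_le Cf.
  split=> // l; split; first by move=> z V'z; have [] := dpsi z l V'z.
  have := class_CN oV' (class_CM oV' (CY _ (class_C_pd (lift j l) Cg))
    (class_CV oV' _ (CY _ (class_C_pd j Cg)))).
  move=> /(_ (fun z V'z => lt0r_neq0 (rhoP _ (psiU z V'z)).2)).
  by apply: class_C_ext => // z V'z; have [_ ->] := dpsi z l V'z.
exists (cube x0 d), V', psi; split=> //.
- exact: nbhs_cube.
- exact: Cpsi.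
- move=> z V'z; have [Uz pz] := rhoP _ (psiU z V'z); split=> //.
  + exact: (psiP z V'z).2.
  + exact: lt0r_neq0.
  + by move=> l; have [_ <-] := dpsi z l V'z.
- move=> x xd gx; have V'x : V' (col' j x) by exact: cube_col'.
  have xrho : `|x 0 j - x0 0 j| < rho by apply: lt_le_trans (xd j) _.
  split=> //; rewrite -[LHS](ins_col' j); congr ins.
  have [_ px] := psiP _ V'x; have [xrho' _] := psiP _ V'x.
  case: (ltrgtP (x 0 j) (psi (col' j x))) => // H.
    by have := mono _ _ _ (V'rho _ V'x) xrho xrho' H; rewrite px ins_col' gx ltxx.
  by have := mono _ _ _ (V'rho _ V'x) xrho' xrho H; rewrite px ins_col' gx ltxx.
Unshelve. all: by end_near. Qed.

(** * Null sets *)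

Section null_sets.
Variables (R : realType) (n : nat).
Implicit Types (A : set 'rV[R]_n).

Lemma prod_sides_ge0 (a b : 'rV[R]_n) : (forall i, a 0 i <= b 0 i) ->
  0 <= \prod_(i < n) (b 0 i - a 0 i).
Proof. by move=> ab; apply: prodr_ge0 => i _; rewrite subr_ge0. Qed.

Lemma lebesgue_nullP A : lebesgue_null A <-> forall e : R, 0 < e ->
  exists (D : set nat) (a b : nat -> 'rV[R]_n),
    [/\ forall k i, a k 0 i <= b k 0 i,
        A `<=` \bigcup_(k in D) box (a k) (b k) &
        (\esum_(k in D) (\prod_(i < n) (b k 0 i - a k 0 i))%:E <= e%:E)%E].
Proof.
rewrite /lebesgue_null /lebesgue_outer; set S := [set s | _].
have S0 : lbound S 0%E.
  move=> _ [D [a [b [ab _ ->]]]]; apply: esum_ge0 => k _.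
  by rewrite lee_fin; exact: prod_sides_ge0.
split=> [A0 e e0|H].
  have : (ereal_inf S < e%:E)%E by rewrite A0 lte_fin.
  by move=> /ereal_inf_lt[s [D [a [b [ab AD ->]]]] /ltW se]; exists D, a, b.
apply/eqP; rewrite eq_le; apply/andP; split; last exact: le_ereal_inf_tmp.
apply/lee_addgt0Pr => e e0; rewrite add0e.
have [D [a [b [ab AD le]]]] := H e e0.
apply: le_trans le; apply: ereal_inf_lbound; by exists D, a, b.
Qed.

Lemma lebesgue_null_sub A B : A `<=` B -> lebesgue_null B -> lebesgue_null A.
Proof.
move=> AB /lebesgue_nullP B0; apply/lebesgue_nullP => e /B0[D [a [b [ab BD le]]]].
by exists D, a, b; split=> //; exact: subset_trans BD.
Qed.

(** The k-th set is covered with total volume at most e / 2^(k+1), and these bounds sum to at most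
    e. *)
Lemma lebesgue_null_bigcup (A : nat -> set 'rV[R]_n) :
  (forall k, lebesgue_null (A k)) -> lebesgue_null (\bigcup_k A k).
Proof.
move=> A0; apply/lebesgue_nullP => e e0.
have H k : exists Dab : set nat * (nat -> 'rV[R]_n) * (nat -> 'rV[R]_n),
    [/\ forall l i, Dab.1.2 l 0 i <= Dab.2 l 0 i,
        A k `<=` \bigcup_(l in Dab.1.1) box (Dab.1.2 l) (Dab.2 l) &
        (\esum_(l in Dab.1.1) (\prod_(i < n) (Dab.2 l 0 i - Dab.1.2 l 0 i))%:E
          <= (e / (2 ^ k.+1)%:R)%:E)%E].
  have ek : 0 < e / (2 ^ k.+1)%:R by rewrite divr_gt0// ltr0n expn_gt0.
  by have /lebesgue_nullP/(_ _ ek)[D [a [b [? ? ?]]]] := A0 k; exists (D, a, b).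
have [F FP] := choice H.
(* Pairs of indices are encoded as naturals. The default 0 is only taken outside the index set of
   the cover, where it still satisfies [a <= b]. *)
pose a m := if unpickle m is Some kl then (F kl.1).1.2 kl.2 else 0.
pose b m := if unpickle m is Some kl then (F kl.1).2 kl.2 else 0.
pose P : set (nat * nat) := setT `*`` (fun k => (F k).1.1).
exists (@pickle (nat * nat)%type @` P), a, b; split.
- by move=> m i; rewrite /a /b; case: unpickle => [[k l]|//]; have [] := FP k.
- move=> x [k _ Akx]; have [_ /(_ _ Akx)[l Dl xl] _] := FP k.
  exists (pickle (k, l)); first by exists (k, l).
  by rewrite /a /b pickleK.
- rewrite esum_image; last by move=> x y _ _; exact: (pcan_inj pickleK).
  rewrite (eq_esum (b := fun kl => (\prod_(i < n) ((F kl.1).2 kl.2 0 i - (F kl.1).1.2 kl.2 0 i))%:E)); last first.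
    by move=> kl _; rewrite /a /b pickleK.
  rewrite -(esum_esum (a := fun k l => (\prod_(i < n) ((F k).2 l 0 i - (F k).1.2 l 0 i))%:E)); last first.
    by move=> k l _ _; rewrite lee_fin; apply: prod_sides_ge0; have [] := FP k.
  apply: (@le_trans _ _ (\esum_(k in setT) (e / (2 ^ k.+1)%:R)%:E)%E).
    by apply: le_esum => k _; have [] := FP k.
  rewrite -nneseries_esumT; first exact: epsilon_trick0 (ltW e0).
  by move=> k; rewrite lee_fin divr_ge0// ltW.
Qed.

Lemma lebesgue_null0 : lebesgue_null (set0 : set 'rV[R]_n).
Proof.
apply/lebesgue_nullP => e e0; exists set0, (fun=> 0), (fun=> 0); split=> //.
by rewrite esum_set0 lee_fin ltW.
Qed.

Lemma lebesgue_null_countable (I : countType) (A : I -> set 'rV[R]_n) :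
  (forall i, lebesgue_null (A i)) -> lebesgue_null (\bigcup_i A i).
Proof.
move=> A0.
have : lebesgue_null (\bigcup_m (if unpickle m is Some i then A i else set0)).
  by apply: lebesgue_null_bigcup => m; case: unpickle => [i//|]; exact: lebesgue_null0.
apply: lebesgue_null_sub => x [i _ Ax]; exists (pickle i) => //.
by rewrite pickleK.
Qed.

Lemma lebesgue_nullU A B : lebesgue_null A -> lebesgue_null B -> lebesgue_null (A `|` B).
Proof.
move=> A0 B0; have : lebesgue_null (\bigcup_(c : bool) (if c then A else B)).
  by apply: lebesgue_null_countable => -[].
by apply: lebesgue_null_sub => x [Ax|Bx]; [exists true|exists false].
Qed.

Lemma lebesgue_null_cubes A : (forall e : R, 0 < e ->
  exists (I : finType) (c : I -> 'rV[R]_n) (w : R),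
   [/\ 0 <= w, forall x, A x -> exists i, forall k, `|x 0 k - c i 0 k| <= w &
      #|I|%:R * (2 * w) ^+ n <= e]) -> lebesgue_null A.
Proof.
move=> H; apply/lebesgue_nullP => e /H[I [c [w [w0 cov le]]]].
pose a m : 'rV[R]_n := if unpickle m is Some i then c i - const_mx w else 0.
pose b m : 'rV[R]_n := if unpickle m is Some i then c i + const_mx w else 0.
exists (@pickle I @` [set` enum I]), a, b; split.
- move=> m k; rewrite /a /b; case: unpickle => [i|//]; rewrite !mxE; lra.
- move=> x /cov[i xi]; exists (pickle i); first by exists i => //=; rewrite mem_enum.
  move=> k; rewrite /a /b pickleK !mxE; have := xi k; rewrite ler_norml; lra.
- rewrite esum_image; last by move=> x y _ _; exact: (pcan_inj pickleK).
  rewrite (eq_esum (b := fun i => ((2 * w) ^+ n)%:E)); last first.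
    move=> i _; congr (_%:E); rewrite /a /b pickleK.
    rewrite (eq_bigr (fun=> 2 * w)) ?prodr_const ?card_ord// => k _.
    rewrite !mxE; lra.
  rewrite esum_fset//; last by move=> i _; rewrite lee_fin exprn_ge0// mulr_ge0.
  rewrite -fsbig_seq ?enum_uniq// sumEFin lee_fin (le_trans _ le)//.
  by rewrite big_enum/= sumr_const -(mulr_natl (_ ^+ n)).
Qed.

End null_sets.

(** A Lindelof argument: cubes with rational centres and radii 1/(k+1) form a countable base, and
    countably many null images cover the whole image. *)
Lemma null_image_local (R : realType) n m (F : 'rV[R]_n -> 'rV[R]_m) (E : set 'rV[R]_n) :
  (forall x, E x -> exists2 V, nbhs x V & lebesgue_null (F @` (E `&` V))) ->
  lebesgue_null (F @` E).
Proof.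
move=> H.
pose Q (i : 'rV[rat]_n * nat) : set 'rV[R]_n := cube (map_mx ratr i.1) (i.2.+1%:R^-1).
(* This is the image of the i-th piece when that image is null, and empty otherwise, so every [A i]
   is null. *)
pose A i := [set y | lebesgue_null (F @` (E `&` Q i)) /\ (F @` (E `&` Q i)) y].
suff : F @` E `<=` \bigcup_i A i.
  move=> /lebesgue_null_sub; apply; apply: lebesgue_null_countable => i.
  have [Ni|Ni] := pselect (lebesgue_null (F @` (E `&` Q i))).
    by apply: lebesgue_null_sub Ni => y [].
  by apply: lebesgue_null_sub (@lebesgue_null0 _ _) => y [].
move=> _ [x Ex <-]; have [V /nbhs_cubeP[e e0 eV] FV] := H x Ex.
(* A cube of radius 1/(k+1) containing x is contained in the cube of radius 2/(k+1) around x, hence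
   in V. *)
have [k ke] : exists k : nat, 2 / k.+1%:R < e.
  have [k] : exists k : nat, 2 / e < k%:R.
    by exists (Num.Def.archi_bound (2 / e)); apply: archi_boundP; rewrite divr_ge0// ltW.
  rewrite ltr_pdivrMr// => ke; exists k; rewrite ltr_pdivrMr// mulrC.
  by apply: lt_le_trans ke _; rewrite ler_wpM2r ?ler_nat// ltW.
have k0 : 0 < k.+1%:R^-1 :> R by rewrite invr_gt0.
have /choice[q qP] : forall i, exists q : rat, `|x 0 i - ratr q| < k.+1%:R^-1.
  move=> i; set c := _^-1; have xc : x 0 i - c < x 0 i + c by rewrite ltrBlDr -addrA ltrDl addr_gt0.
  have [q] := rat_in_itvoo xc.
  rewrite in_itv/= => /andP[q1 q2]; exists q; rewrite ltr_norml; apply/andP; split; lra.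
have xQ : Q (\row_i q i, k) x by move=> i; rewrite !mxE.
have QV : Q (\row_i q i, k) `<=` V.
  move=> y yQ; apply: eV => i; have := yQ i; rewrite !mxE/= => yi.
  have := ler_distD (ratr (q i)) (y 0 i) (x 0 i).
  rewrite (distrC (ratr _) (x 0 i)) => H1; have H2 := qP i.
  rewrite (le_lt_trans H1)// (lt_trans (ltrD yi H2))//. by move: ke; rewrite mulr_natl mulr2n.
exists (\row_i q i, k) => //; split.
  by apply: lebesgue_null_sub FV; apply: image_subset => y [Ey /QV].
by exists x.
Qed.

(** * Flat functions *)

(* The module generated by [A] over the continuous functions on [U]. *)
Inductive cspan (R : realType) (n : nat) (U : set 'rV[R]_n)
    (A : ('rV[R]_n -> R) -> Prop) : ('rV[R]_n -> R) -> Prop :=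
| cspan_zero (f : 'rV[R]_n -> R) : (forall x, U x -> f x = 0) -> cspan U A f
| cspan_add (f a b g : 'rV[R]_n -> R) : A a -> (forall x, U x -> {for x, continuous b}) ->
    cspan U A g -> (forall x, U x -> f x = b x * a x + g x) -> cspan U A f.

(* [flat U E T k i f]: the function f and its iterated derivatives along [T] up
   to order i vanish on [E], up to continuous coefficients; the regularity k
   only concerns the functions reached after i derivations. Keeping the
   coefficients merely continuous is what makes this notion stable when a
   variable is eliminated by an implicit function of class C^k. *)
Fixpoint flat (R : realType) (n : nat) (U E : set 'rV[R]_n) (T : pred 'I_n)
    (k i : nat) (f : 'rV[R]_n -> R) : Prop :=
  match i with
  | 0%N => class_C k U f /\ (forall x, E x -> f x = 0)
  | i'.+1 => [/\ class_C 1 U f, forall x, E x -> f x = 0 &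
      forall l, T l -> cspan U (flat U E T k i') (pd l f)]
  end.

(** * Estimates for flat functions *)

Section bounds.
Variables (R : realType) (n : nat) (U E : set 'rV[R]_n) (T : pred 'I_n).
Hypothesis (oU : open U).
Implicit Types (f g : 'rV[R]_n -> R) (x y : 'rV[R]_n) (K : R).

(* The parameter K is both the constant of the estimate and the inverse of the
   radius of the cube where it holds, so that enlarging K weakens the claim. *)
Definition flat_bound x0 i f K := forall x y d, E x -> cube x0 K^-1 x ->
  cube x0 K^-1 y -> (forall l, ~~ T l -> y 0 l = x 0 l) ->
  0 <= d -> (forall l, `|y 0 l - x 0 l| <= d) -> `|f y| <= K * d ^+ i.

Lemma cube_inv_le x K K' : 0 < K -> K <= K' -> cube x K'^-1 `<=` cube x K^-1.
Proof.
move=> K0 KK' y xy l; apply: lt_le_trans (xy l) _.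
by rewrite lef_pV2// posrE (lt_le_trans K0).
Qed.

Lemma nbhs_cube_inv x (A : set 'rV[R]_n) : nbhs x A ->
  exists2 K, 0 < K & cube x K^-1 `<=` A.
Proof.
move=> /nbhs_cubeP[e e0 eA]; exists e^-1; first by rewrite invr_gt0.
by rewrite invrK.
Qed.

Lemma continuous_bounded f x0 : {for x0, continuous f} ->
  exists2 K, 0 < K & forall y, cube x0 K^-1 y -> `|f y| <= K.
Proof.
move=> cf; have : nbhs x0 [set y | `|f x0 - f y| < 1].
  by move: cf => /cvgrPdist_lt/(_ _ ltr01).
move=> /nbhs_cube_inv[K K0 KA].
have fx0 := normr_ge0 (f x0).
exists (K + `|f x0| + 1); first lra.
move=> y /(cube_inv_le K0); have KK : K <= K + `|f x0| + 1 by lra.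
move=> /(_ KK)/KA/= fy.
have := ler_normB (f x0) (f x0 - f y); rewrite subKr => H.
by apply: le_trans H _; lra.
Qed.

(** Continuous coefficients are locally bounded, so they only enlarge the constant. *)
Lemma flat_bound_cspan A x0 i f : U x0 ->
  (forall a, A a -> exists2 K, 0 < K & flat_bound x0 i a K) ->
  cspan U A f -> exists2 K, 0 < K & flat_bound x0 i f K.
Proof.
move=> Ux0 AB; have [KU KU0 KUP] := nbhs_cube_inv (open_nbhs_nbhs (conj oU Ux0)).
elim=> [{}f f0|{}f a b g Aa cb _ [Kg Kg0 gP] fE].
  exists KU => // x y d Ex x0x /KUP/f0 -> _ d0 _.
  by rewrite normr0 mulr_ge0 ?exprn_ge0// ltW.
have [Ka Ka0 aP] := AB _ Aa; have [Kb Kb0 bP] := continuous_bounded (cb _ Ux0).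
(* A single K must dominate all inverse radii as well as the constant [Kb * Ka + Kg] of the
   combination. *)
pose K := Ka + Kb + Kg + KU + Kb * Ka.
have KbKa : 0 < Kb * Ka by rewrite mulr_gt0.
exists K; first by rewrite /K; lra.
have [Ka1 Kb1 Kg1 KU1] : [/\ Ka <= K, Kb <= K, Kg <= K & KU <= K].
  by rewrite /K; split; lra.
move=> x y d Ex x0x x0y xy d0 xyd.
rewrite fE; last by apply/KUP; exact: cube_inv_le x0y.
have dd : 0 <= d ^+ i by exact: exprn_ge0.
apply: (le_trans (ler_normD _ _)); rewrite normrM.
have Hb := bP _ (cube_inv_le Kb0 Kb1 x0y).
have Ha := aP x y d Ex (cube_inv_le Ka0 Ka1 x0x) (cube_inv_le Ka0 Ka1 x0y) xy d0 xyd.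
have Hg := gP x y d Ex (cube_inv_le Kg0 Kg1 x0x) (cube_inv_le Kg0 Kg1 x0y) xy d0 xyd.
apply: (le_trans (lerD (ler_pM (normr_ge0 _) (normr_ge0 _) Hb Ha) Hg)).
by rewrite mulrA -mulrDl ler_wpM2r// /K; lra.
Qed.

Lemma sum_le_ge0 (I : finType) (K : I -> R) i : (forall i, 0 < K i) -> K i <= \sum_i K i.
Proof.
move=> K0; rewrite (bigD1 i)//= lerDl sumr_ge0// => j _; exact: ltW.
Qed.

Lemma between_dist (a b z t : R) : 0 <= t <= 1 -> z = a + t * (b - a) -> `|z - a| <= `|b - a|.
Proof.
move=> /andP[t0 t1] ->; rewrite addrAC subrr add0r normrM (ger0_norm t0).
by rewrite ler_piMl.
Qed.

(** Integrating bounds on the derivatives along T gains one power of d: the points given by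
    [mvt_cube] share the coordinates of x outside T, so those bounds hold there. The difference
    [f y - f x] is estimated because f itself may not vanish on E. *)
Lemma flat_bound_step x0 i f : U x0 -> class_C 1 U f ->
  (forall l, T l -> exists2 K, 0 < K & flat_bound x0 i (pd l f) K) ->
  exists2 K, 0 < K & forall x y d, E x -> cube x0 K^-1 x ->
    cube x0 K^-1 y -> (forall l, ~~ T l -> y 0 l = x 0 l) ->
    0 <= d -> (forall l, `|y 0 l - x 0 l| <= d) -> `|f y - f x| <= K * d ^+ i.+1.
Proof.
move=> Ux0 Cf H; have [KU KU0 KUP] := nbhs_cube_inv (open_nbhs_nbhs (conj oU Ux0)).
have /choice[K KP] : forall l, exists K, 0 < K /\ (T l -> flat_bound x0 i (pd l f) K).
  move=> l; have [Tl|Tl] := boolP (T l); last by exists 1.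
  by have [K K0 KP] := H l Tl; exists K.
have K0 l : 0 < K l by have [] := KP l.
pose S := KU + \sum_l K l; have SK l : K l <= S.
  by apply: le_trans (sum_le_ge0 l K0) _; rewrite lerDr ltW.
have S0 : 0 <= \sum_l K l by apply: sumr_ge0 => l _; exact: ltW.
have SU : KU <= S by rewrite lerDl.
exists S; first exact: lt_le_trans SU.
move=> x y d Ex x0x x0y xy d0 xyd.
have [z zb l|p [pb ->]] := @mvt_cube R n f x y.
  apply: class_C_derivable Cf _; apply/KUP/(cube_inv_le KU0 SU).
  exact: between_cube zb x0x x0y.
apply: (le_trans (ler_norm_sum _ _ _)); apply: (@le_trans _ _ (\sum_l d * (K l * d ^+ i))).
  apply: ler_sum => l _; rewrite normrM.
  have [Tl|Tl] := boolP (T l); last first.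
    by rewrite xy// subrr normr0 mul0r !mulr_ge0 ?exprn_ge0// ltW.
  apply: ler_pM => //; have [_ /(_ Tl)] := KP l; apply; first exact: Ex.
  - exact: cube_inv_le x0x.
  - by apply: (cube_inv_le (K0 l) (SK l)); exact: between_cube (pb l) x0x x0y.
  - by move=> l' Tl'; have [t _ ->] := pb l l'; rewrite xy// subrr mulr0 addr0.
  - exact: d0.
  - by move=> l'; have [t t01 /(between_dist t01)/le_trans] := pb l l'; apply.
rewrite -mulr_sumr -mulr_suml mulrCA -exprS ler_wpM2r ?exprn_ge0//.
by rewrite lerDr ltW.
Qed.

Lemma flat_flat_bound x0 i f : U x0 -> flat U E T 0 i f ->
  exists2 K, 0 < K & flat_bound x0 i f K.
Proof.
move=> Ux0; elim: i f => [|i IH] f.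
  move=> [[cf _] _]; have [K K0 KP] := continuous_bounded (cf _ Ux0).
  by exists K => // x y d Ex x0x x0y xy d0 xyd; rewrite expr0 mulr1; exact: KP.
move=> [Cf fE Df]; have [|K K0 KP] := flat_bound_step (i := i) Ux0 Cf.
  by move=> l Tl; exact: flat_bound_cspan Ux0 IH (Df l Tl).
exists K => // x y d Ex x0x x0y xy d0 xyd.
by have := KP x y d Ex x0x x0y xy d0 xyd; rewrite (fE x Ex) subr0.
Qed.

Lemma flat_lipschitz i f x0 : U x0 -> class_C 1 U f ->
  (forall l, T l -> cspan U (flat U E T 0 i) (pd l f)) ->
  exists2 K, 0 < K & forall x y d, E x -> cube x0 K^-1 x -> cube x0 K^-1 y ->
    0 <= d -> (forall l, T l -> `|y 0 l - x 0 l| <= d) ->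
    (forall l, ~~ T l -> `|y 0 l - x 0 l| <= d ^+ i.+1) ->
    `|f y - f x| <= K * d ^+ i.+1.
Proof.
move=> Ux0 Cf Df; have [|K1 K10 K1P] := flat_bound_step (i := i) Ux0 Cf.
  by move=> l Tl; apply: flat_bound_cspan (Df l Tl) => // a; exact: flat_flat_bound.
have [KU KU0 KUP] := nbhs_cube_inv (open_nbhs_nbhs (conj oU Ux0)).
have /choice[K KP] : forall l, exists K, 0 < K /\ forall y, cube x0 K^-1 y -> `|pd l f y| <= K.
  move=> l; have [K K0 KP] := continuous_bounded (class_C_continuous (class_C_pd l Cf) Ux0).
  by exists K.
have K0 l : 0 < K l by have [] := KP l.
pose S := K1 + KU + \sum_l K l.
have S0 : 0 <= \sum_l K l by apply: sumr_ge0 => l _; exact: ltW.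
have SK l : K l <= S.
  by apply: le_trans (sum_le_ge0 l K0) _; rewrite lerDr addr_ge0 ?ltW.
have SU : KU <= S by rewrite /S; lra.
have S1 : K1 <= S by rewrite /S; lra.
exists S; first exact: lt_le_trans SU.
move=> x y d Ex x0x x0y d0 xyT xyS.
(* The coordinates in T move first, because the flat estimate has to start from the point x of E;
   the remaining move has size [d ^+ i.+1] and only needs bounded partial derivatives. *)
pose w : 'rV[R]_n := \row_l (if T l then y 0 l else x 0 l).
have x0w : cube x0 S^-1 w by move=> l; rewrite mxE; case: ifP.
have Hx : `|f w - f x| <= K1 * d ^+ i.+1.
  apply: K1P => //.
  - exact: cube_inv_le x0x.
  - exact: cube_inv_le x0w.
  - by move=> l Tl; rewrite mxE (negPf Tl).
  - by move=> l; rewrite mxE; case: ifPn => [/xyT//|]; rewrite subrr normr0.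
have Hy : `|f y - f w| <= (\sum_l K l) * d ^+ i.+1.
  have [z zb l|p [pb ->]] := @mvt_cube R n f w y.
    apply: class_C_derivable Cf _; apply/KUP/(cube_inv_le KU0 SU).
    exact: between_cube zb x0w x0y.
  apply: (le_trans (ler_norm_sum _ _ _)); rewrite mulr_suml; apply: ler_sum => l _.
  rewrite normrM mulrC ler_pM//.
    have [_] := KP l; apply; apply: (cube_inv_le (K0 l) (SK l)).
    exact: between_cube (pb l) x0w x0y.
  by rewrite mxE; case: ifPn => [|/xyS//]; rewrite subrr normr0 exprn_ge0.
rewrite -(subrKA (f w)); apply: (le_trans (ler_normD _ _)).
apply: (le_trans (lerD Hy Hx)); rewrite -mulrDl ler_wpM2r ?exprn_ge0// /S; lra.
Qed.

End bounds.

(* The grid has mesh 1/M along T and (1/M)^(i+1) along the other coordinates. *)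
Lemma null_anisotropic (R : realType) n m i (E : set 'rV[R]_n) (T : pred 'I_n)
    (F : 'rV[R]_n -> 'rV[R]_m) x0 rho C : 0 < rho -> E `<=` cube x0 rho -> 0 <= C ->
  (forall x y d, E x -> E y -> 0 <= d -> (forall l, T l -> `|y 0 l - x 0 l| <= d) ->
    (forall l, ~~ T l -> `|y 0 l - x 0 l| <= d ^+ i.+1) ->
    forall c, `|F y 0 c - F x 0 c| <= C * d ^+ i.+1) ->
  (#|predC T| < m)%N -> (#|T| <= i)%N -> lebesgue_null (F @` E).
Proof.
move=> rho0 Erho C0 FC Tm Ti; apply: lebesgue_null_cubes => e e0.
(* D bounds the side of the cube, so [D * M ^ p l] intervals of length M^(-p l) suffice along
   coordinate l. *)
have [D D0 DP] : exists2 D : nat, (0 < D)%N & 2 * rho <= D%:R.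
  exists (Num.Def.archi_bound (2 * rho)).+1 => //.
  rewrite (le_trans (ltW (archi_boundP _)))// ?ler_nat//.
  by rewrite mulr_ge0// ltW.
(* The total volume of the covering cubes will be at most B / M. *)
pose B := D%:R ^+ n * (2 * C) ^+ m.
have B0 : 0 <= B by rewrite mulr_ge0// exprn_ge0// mulr_ge0.
have [M M0 MP] : exists2 M : nat, (0 < M)%N & B / e <= M%:R.
  exists (Num.Def.archi_bound (B / e)).+1 => //.
  rewrite (le_trans (ltW (archi_boundP _)))// ?ler_nat//.
  by rewrite divr_ge0// ltW.
have MR0 : 0 < M%:R :> R by rewrite ltr0n.
pose p l := if T l then 1%N else i.+1.
pose N l := (D * M ^ p l)%N.
pose I := {dffun forall l : 'I_n, 'I_(N l)}.
pose cell (j : I) : set 'rV[R]_n := [set x | E x /\ forall l,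
  (j l)%:R <= (x 0 l - x0 0 l + rho) * M%:R ^+ p l < (j l).+1%:R].
(* A point of E is picked in each cell; the default [x0] only serves cells that contain none. *)
pose q j : 'rV[R]_n := xget x0 (cell j).
exists I, (fun j => F (q j)), (C * (M%:R^-1) ^+ i.+1); split.
- by rewrite mulr_ge0// exprn_ge0// invr_ge0.
- move=> _ [x Ex <-].
  have xN l : (Num.truncn ((x 0 l - x0 0 l + rho) * M%:R ^+ p l)%R < N l)%N.
    have := Erho _ Ex l; rewrite ltr_norml => /andP[x1 x2].
    have Mp : 0 < M%:R ^+ p l :> R by rewrite exprn_gt0.
    rewrite -(ltr_nat R); apply: (@le_lt_trans _ _ ((x 0 l - x0 0 l + rho) * M%:R ^+ p l)).
      have x0l : 0 <= (x 0 l - x0 0 l + rho) * M%:R ^+ p l by rewrite mulr_ge0 ?(ltW Mp)//; lra.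
      by have /andP[] := truncn_itv x0l.
    rewrite natrM natrX ltr_pM2r//; lra.
  pose j : I := [ffun l => Ordinal (xN l)].
  have jx : cell j x.
    split=> // l; rewrite ffunE/=; apply: truncn_itv.
    have := Erho _ Ex l; rewrite ltr_norml => /andP[x1 x2].
    by rewrite mulr_ge0 ?exprn_ge0//; lra.
  have [Eq jq] : cell j (q j) by apply: xgetPex; exists x.
  have [_ {}jx] := jx.
  have xq l : `|x 0 l - q j 0 l| <= (M%:R^-1) ^+ p l.
    have Mp : 0 < M%:R ^+ p l :> R by rewrite exprn_gt0.
    have /andP[q1 q2] := jq l; have /andP[x1 x2] := jx l.
    rewrite exprVn -[_^-1]mul1r ler_pdivlMr// -(ger0_norm (ltW Mp)) -normrM.
    have -> : (x 0 l - q j 0 l) * M%:R ^+ p l = (x 0 l - x0 0 l + rho) * M%:R ^+ p l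
       - (q j 0 l - x0 0 l + rho) * M%:R ^+ p l by ring.
    move: q2 x2; rewrite -[(j l).+1]addn1 natrD ler_norml => q2 x2; apply/andP; split; lra.
  exists j => k; apply: FC => //.
  + by move=> l Tl; have := xq l; rewrite /p Tl expr1.
  + by move=> l Tl; have := xq l; rewrite /p (negPf Tl).
- have -> : #|I| = (D ^ n * M ^ (#|T| + i.+1 * #|predC T|))%N.
    rewrite card_dep_ffun foldrE big_map big_enum/=.
    under eq_bigr do rewrite card_ord.
    rewrite /N big_split/= prod_nat_const card_ord -expn_sum; congr (_ * _ ^ _)%N.
    rewrite (bigID T)/= /p; congr (_ + _)%N.
      by under eq_bigr => l -> do []; rewrite sum1_card.
    under eq_bigr => l /negPf -> do []; rewrite sum_nat_const mulnC.
    by congr (_ * _)%N; apply: eq_card => l; rewrite !inE.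
  rewrite natrM !natrX [2 * _]mulrA exprMn mulrACA -/B.
  rewrite -exprM exprVn.
  (* Both dimension hypotheses enter here: the number of cells grows by at least one power of M less
     than the inverse volume of an image cube. *)
  have E1 : (#|T| + i.+1 * #|predC T| + 1 <= i.+1 * m)%N.
    apply: (@leq_trans (i.+1 * #|predC T|.+1)); last by rewrite leq_mul2l.
    by rewrite mulnS addnAC leq_add2r addn1 ltnS.
  have E2 : M%:R ^+ (#|T| + i.+1 * #|predC T|) / M%:R ^+ (i.+1 * m) <= M%:R^-1 :> R.
    rewrite ler_pdivrMr ?exprn_gt0// ler_pdivlMl// -exprS -addn1.
    by apply: ler_weXn2l; rewrite ?ler1n.
  apply: (le_trans (ler_wpM2l B0 E2)).
  by rewrite ler_pdivrMr// mulrC -ler_pdivrMr.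
Qed.

(** On a small cube around each point, [flat_lipschitz] holds with one constant for all components
    of F, and the grid count applies. *)
Lemma null_flat_image (R : realType) n m i (U E : set 'rV[R]_n) (T : pred 'I_n)
    (F : 'rV[R]_n -> 'rV[R]_m) : open U -> E `<=` U ->
  (forall c, class_C 1 U (fun x => F x 0 c)) ->
  (forall c l, T l -> cspan U (flat U E T 0 i) (pd l (fun x => F x 0 c))) ->
  (#|predC T| < m)%N -> (#|T| <= i)%N -> lebesgue_null (F @` E).
Proof.
move=> oU EU CF DF Tm Ti; apply: null_image_local => x0 Ex0.
have Ux0 := EU _ Ex0.
have /choice[K KP] : forall c, exists K, 0 < K /\ forall x y d, E x ->
    cube x0 K^-1 x -> cube x0 K^-1 y ->
    0 <= d -> (forall l, T l -> `|y 0 l - x 0 l| <= d) ->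
    (forall l, ~~ T l -> `|y 0 l - x 0 l| <= d ^+ i.+1) ->
    `|F y 0 c - F x 0 c| <= K * d ^+ i.+1.
  move=> c; have [K K0 KP] := flat_lipschitz oU Ux0 (CF c) (DF c).
  by exists K.
have K0 c : 0 < K c by have [] := KP c.
pose S := 1 + \sum_c K c.
have S0 : 0 < S by rewrite ltr_wpDr// sumr_ge0// => c _; exact: ltW.
have SK c : K c <= S by apply: le_trans (sum_le_ge0 c K0) _; rewrite lerDr.
exists (cube x0 S^-1); first by apply: nbhs_cube; rewrite invr_gt0.
apply: (@null_anisotropic _ _ _ i _ T F x0 S^-1 S) => //.
- by rewrite invr_gt0.
- exact: ltW.
- move=> x y d [Ex x0x] [Ey x0y] d0 H1 H2 c.
  have [_ /(_ x y d Ex (cube_inv_le (K0 c) (SK c) x0x) (cube_inv_le (K0 c) (SK c) x0y) d0 H1 H2)] := KP c.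
  by move=> /le_trans; apply; rewrite ler_wpM2r// exprn_ge0.
Qed.

(** * Continuous combinations and elimination of a variable *)

Section cspan.
Variables (R : realType) (n : nat) (U : set 'rV[R]_n).
Implicit Types (f g h b : 'rV[R]_n -> R) (A B : ('rV[R]_n -> R) -> Prop).

Lemma cspan_gen A f g b : A f -> (forall x, U x -> {for x, continuous b}) ->
  (forall x, U x -> g x = b x * f x) -> cspan U A g.
Proof.
move=> Af cb gE; apply: (cspan_add Af cb (cspan_zero _ (fun x _ => erefl 0))).
by move=> x Ux; rewrite gE// addr0.
Qed.

Lemma cspan_ext A f g : (forall x, U x -> f x = g x) -> cspan U A f -> cspan U A g.
Proof.
move=> fg Sf; case: Sf fg => [{}f f0|{}f a b h Aa cb Sh fE] fg.
  by apply: cspan_zero => x Ux; rewrite -fg ?f0.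
by apply: cspan_add Aa cb Sh _ => x Ux; rewrite -fg ?fE.
Qed.

Lemma cspanD A f g : cspan U A f -> cspan U A g -> cspan U A (fun x => f x + g x).
Proof.
move=> + Sg; elim=> [{}f f0|{}f a b h Aa cb _ Shg fE].
  by apply: cspan_ext Sg => x Ux; rewrite f0 ?add0r.
by apply: cspan_add Aa cb Shg _ => x Ux; rewrite fE// addrA.
Qed.

Lemma cspanM A f b : (forall x, U x -> {for x, continuous b}) -> cspan U A f ->
  cspan U A (fun x => b x * f x).
Proof.
move=> cb; elim=> [{}f f0|{}f a c h Aa cc _ Sbh fE].
  by apply: cspan_zero => x Ux; rewrite f0 ?mulr0.
apply: (cspan_add (b := fun x => b x * c x) Aa _ Sbh) => x Ux.
  by apply: continuousM; [exact: cb|exact: cc].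
by rewrite fE// mulrDr mulrA.
Qed.

Lemma cspan_sub A B f : (forall a, A a -> B a) -> cspan U A f -> cspan U B f.
Proof.
move=> AB; elim=> [{}f f0|{}f a b h /AB Ba cb _ Sh fE]; first exact: cspan_zero.
exact: cspan_add Ba cb Sh fE.
Qed.

End cspan.

(** Only the functions reached after i derivations change: they vanish on E, so by hypothesis their
    derivatives along T vanish on E0, which trades one order of regularity for one order of
    flatness. *)
Lemma flat_shift (R : realType) n (U E E0 : set 'rV[R]_n) (T : pred 'I_n) k i f :
  E0 `<=` E ->
  (forall g, class_C k.+1 U g -> (forall x, E x -> g x = 0) ->
     forall x l, E0 x -> T l -> pd l g x = 0) ->
  flat U E T k.+1 i f -> flat U E0 T k i.+1 f.
Proof.
move=> E0E E0P; elim: i f => [|i IH] f.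
  move=> [Cf fE]; split; first exact: class_C_le Cf.
    by move=> x /E0E/fE.
  move=> l Tl; apply: (@cspan_gen _ _ _ _ (pd l f) _ (fun=> 1)).
  - by split; [exact: class_C_pd|move=> x E0x; exact: E0P].
  - by move=> x _; exact: cst_continuous.
  - by move=> x _; rewrite mul1r.
move=> [Cf fE Df]; split=> //; first by move=> x /E0E/fE.
by move=> l Tl; apply: cspan_sub IH (Df l Tl).
Qed.

Lemma card_lift n (T : pred 'I_n.+1) j :
  #|T| = (T j + #|[pred l | T (lift j l)]|)%N.
Proof.
rewrite -!sum1_card big_mkcond [in RHS]big_mkcond (bigD1_ord j)//=.
Qed.

Section substitution.
Variables (R : realType) (n : nat) (j : 'I_n.+1) (U : set 'rV[R]_n.+1) (V : set 'rV[R]_n).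
Variables (psi : 'rV[R]_n -> R).
Hypotheses (oU : open U) (oV : open V) (VU : forall z, V z -> U (ins j z (psi z))).
Implicit Types (f : 'rV[R]_n.+1 -> R).

Definition subst f z := f (ins j z (psi z)).

Lemma class_C_subst k f : class_C k V psi -> class_C k U f -> class_C k V (subst f).
Proof.
move=> Cpsi; apply: (class_C_comp (H := fun z => ins j z (psi z)) oV oU) => // i.
exact: class_C_ins.
Qed.

Lemma pd_subst k f l z : class_C k.+1 V psi -> class_C k.+1 U f -> V z ->
  pd l (subst f) z = subst (pd (lift j l) f) z + subst (pd j f) z * pd l psi z.
Proof.
move=> Cpsi Cf Vz; apply: pd_ins; first exact: class_C_differentiable Cpsi Vz.
exact: class_C_differentiable Cf (VU Vz).
Qed.

Lemma cspan_subst (A : ('rV[R]_n.+1 -> R) -> Prop) (B : ('rV[R]_n -> R) -> Prop) f :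
  class_C 0 V psi -> (forall a, A a -> B (subst a)) -> cspan U A f -> cspan V B (subst f).
Proof.
move=> Cpsi AB; elim=> [{}f f0|{}f a b h /AB Ba cb _ Sh fE].
  by apply: cspan_zero => z /VU/f0.
apply: (cspan_add (b := subst b) Ba _ Sh) => z Vz; last by rewrite /subst fE//; exact: VU.
have Cb : class_C 0 U b by split.
exact: class_C_continuous (class_C_subst Cpsi Cb) Vz.
Qed.

(** By the chain rule the new derivative combines those along [lift j l] and [j], both in T; its
    coefficient [pd l psi] is only known to be continuous, which the module structure allows. *)
Lemma cspan_pd_subst (A : ('rV[R]_n.+1 -> R) -> Prop) (B : ('rV[R]_n -> R) -> Prop)
    (T : pred 'I_n.+1) f l :
  class_C 1 V psi -> class_C 1 U f -> (forall a, A a -> B (subst a)) ->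
  (forall l, T l -> cspan U A (pd l f)) -> T j -> T (lift j l) ->
  cspan V B (pd l (subst f)).
Proof.
move=> Cpsi Cf AB Sf Tj Tl; have C0 := class_CS Cpsi.
have S1 := cspan_subst C0 AB (Sf _ Tl).
have S2 := cspan_subst C0 AB (Sf _ Tj).
have cpsi z : V z -> {for z, continuous (pd l psi)}.
  exact: class_C_continuous (class_C_pd l Cpsi).
apply: cspan_ext (cspanD S1 (cspanM cpsi S2)) => z Vz.
by rewrite (pd_subst _ Cpsi Cf Vz) [X in _ + X]mulrC.
Qed.

(** Induction on the order, with [cspan_pd_subst] for the derivatives; the functions reached at the
    end stay C^(k+1) because [psi] is. *)
Lemma flat_subst (E : set 'rV[R]_n.+1) (T : pred 'I_n.+1) k i f :
  T j -> class_C k.+1 V psi -> flat U E T k.+1 i f ->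
  flat V [set z | V z /\ E (ins j z (psi z))] [pred l | T (lift j l)] k.+1 i (subst f).
Proof.
move=> Tj Cpsi; elim: i f => [|i IH] f.
  by move=> [Cf fE]; split; [exact: class_C_subst|move=> z [_ /fE]].
move=> [Cf fE Df]; have C1 := class_C_le (ltn0Sn k) Cpsi; split.
- exact: class_C_subst.
- by move=> z [_ /fE].
- move=> l Tl; exact: cspan_pd_subst IH Df Tj Tl.
Qed.

End substitution.

(* Induction on n + k: passing from E to E0 exchanges one derivative for one
   order of flatness, and outside E0 a variable of T is eliminated. *)
Lemma null_flat_critical (R : realType) m n k i (U E : set 'rV[R]_n) (T : pred 'I_n)
    (F : 'rV[R]_n -> 'rV[R]_m) : open U -> E `<=` U ->
  (forall c, class_C 1 U (fun x => F x 0 c)) ->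
  (forall c l, T l -> cspan U (flat U E T k i) (pd l (fun x => F x 0 c))) ->
  (#|predC T| < m)%N -> (#|T| <= i + k)%N -> lebesgue_null (F @` E).
Proof.
have [N] := ubnP (n + k); elim: N => // N IH in n k i U E T F *.
case: k => [|k] nkN oU EU CF DF Tm Ti.
  by rewrite addn0 in Ti; exact: null_flat_image DF Tm Ti.
(* Points of E where every C^(k+1) function vanishing on E is critical along T. *)
pose E0 := [set x | E x /\ forall g, class_C k.+1 U g -> (forall x, E x -> g x = 0) ->
     forall l, T l -> pd l g x = 0].
have E0E : E0 `<=` E by move=> x [].
have EE : F @` E `<=` F @` E0 `|` F @` (E `\` E0).
  by move=> _ [x Ex <-]; have [E0x|E0x] := pselect (E0 x); [left|right]; exists x.
apply: lebesgue_null_sub EE _; apply: lebesgue_nullU.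
  (* k drops by one and i grows by one, so [i + k] is kept. *)
  apply: (IH n k i.+1 U E0 T F) => //.
  - by rewrite addnS ltnS in nkN.
  - exact: subset_trans EU.
  - move=> c l Tl; apply: cspan_sub (DF c l Tl) => a.
    by apply: flat_shift => // g Cg gE x l' [_ /(_ g Cg gE l')].
  - by rewrite addSnnS.
apply: null_image_local => x0 [Ex0 nE0].
have [g [j [Cg gE Tj gj]]] : exists g j, [/\ class_C k.+1 U g, forall x, E x -> g x = 0,
    T j & pd j g x0 != 0].
  apply: contrapT => H; apply: nE0; split=> // g Cg gE l Tl.
  by apply/eqP; apply: contrapT => /negP gl; apply: H; exists g, l.
case: n => [|n] in U E T F nkN oU EU CF DF Tm Ti E0 E0E x0 Ex0 nE0 g j Cg gE Tj gj *.
  by case: j {Tj gj}.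
have [V [V' [psi [Vx0 oV' Cpsi V'P VP]]]] := implicit_function oU (EU _ Ex0) Cg (gE _ Ex0) gj.
exists V => //.
pose E' := [set z | V' z /\ E (ins j z (psi z))].
have V'U z : V' z -> U (ins j z (psi z)) by move=> /V'P[].
have C1 := class_C_le (ltn0Sn k) Cpsi.
have : lebesgue_null ((fun z => F (ins j z (psi z))) @` E').
  (* Now n drops. As j is in T, the complement of T keeps its cardinal. *)
  apply: (IH n k.+1 i V' E' [pred l | T (lift j l)]) => //.
  - by move=> z [].
  - by move=> c; exact: (class_C_subst oU oV' V'U C1 (CF c)).
  - move=> c l Tl; apply: (cspan_pd_subst oU oV' V'U C1 (CF c) _ (DF c) Tj Tl) => a.
    exact: flat_subst.
  - by move: Tm; rewrite (card_lift _ j)/= Tj.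
  - by apply: leq_trans Ti; rewrite [leqRHS](card_lift _ j) leq_addl.
apply: lebesgue_null_sub => _ [x [[Ex _] Vx] <-].
have [V'x xE] := VP _ Vx (gE _ Ex); exists (col' j x); last by rewrite -xE.
by split=> //; rewrite -xE.
Qed.

(** * Critical parameters *)

(** The derivatives of F along T vanish on U: T holds the state variables and its complement the
    parameters. Where some constraint has a nonzero derivative along T, a variable of T is
    eliminated and the multipliers survive. Where there is none, the multipliers supply a constraint
    that eliminates a parameter, and [null_flat_critical] concludes. *)
Lemma null_critical_parameters (R : realType) m n p r (U E : set 'rV[R]_n) (T : pred 'I_n)
    (G : 'I_p -> 'rV[R]_n -> R) (F : 'rV[R]_n -> 'rV[R]_m) : open U -> E `<=` U ->
  (forall k, class_C r.+1 U (G k)) -> (forall k x, E x -> G k x = 0) ->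
  (forall c, class_C 1 U (fun x => F x 0 c)) ->
  (forall c l x, U x -> T l -> pd l (fun x => F x 0 c) x = 0) ->
  (forall x, E x -> exists lam : 'I_p -> R,
     (forall l, T l -> \sum_k lam k * pd l (G k) x = 0) /\
     exists2 l, ~~ T l & \sum_k lam k * pd l (G k) x != 0) ->
  (#|predC T| <= m)%N -> (#|T| <= r)%N -> lebesgue_null (F @` E).
Proof.
elim: n => [|n IH] in U E T G F *.
  (* Without coordinates the multiplier condition has no witness, so E is empty. *)
  move=> _ _ _ _ _ _ H _ _; apply: (lebesgue_null_sub _ (@lebesgue_null0 _ _)) => y [x Ex _].
  by have [lam [_ [l _]]] := H x Ex; case: l.
move=> oU EU CG GE CF DF H Tm Tr.
pose E0 := [set x | E x /\ forall k l, T l -> pd l (G k) x = 0].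
have EE : F @` E `<=` F @` E0 `|` F @` (E `\` E0).
  by move=> _ [x Ex <-]; have [E0x|E0x] := pselect (E0 x); [left|right]; exists x.
apply: (lebesgue_null_sub EE).
apply: lebesgue_nullU; apply: null_image_local => x0.
  move=> [Ex0 dG0]; have Ux0 := EU _ Ex0.
  have [lam [_ [j Tj lamj]]] := H _ Ex0.
  have [k gj] : exists k, pd j (G k) x0 != 0.
    apply: contrapT => nk; move/negP: lamj; apply; apply/eqP; apply: big1 => k _.
    by rewrite (_ : pd j (G k) x0 = 0) ?mulr0//; apply/eqP; apply: contrapT => /negP ?; apply: nk; exists k.
  have [V [V' [psi [Vx0 oV' Cpsi V'P VP]]]] := implicit_function oU Ux0 (CG k) (GE _ _ Ex0) gj.
  exists V => //.
  have V'U z : V' z -> U (ins j z (psi z)) by move=> /V'P[].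
  have C1 := class_C_le (ltn0Sn r) Cpsi.
  pose E' := [set z | V' z /\ E0 (ins j z (psi z))].
  have : lebesgue_null ((fun z => F (ins j z (psi z))) @` E').
    apply: (@null_flat_critical _ _ _ r 0 V' E' [pred l | T (lift j l)]) => //.
    - by move=> z [].
    - by move=> c; exact: (class_C_subst oU oV' V'U C1 (CF c)).
    - move=> c l Tl.
      (* Since F is stationary along T, the composite varies only through [psi]: its derivative is a
         continuous multiple of the derivative of the constraint, which is C^r and vanishes on
         E'. *)
      apply: (@cspan_gen _ _ _ _ (subst j psi (pd (lift j l) (G k))) _
        (fun z => - (subst j psi (pd j (fun x => F x 0 c)) z / subst j psi (pd j (G k)) z))).
      + split; first by apply: class_C_subst (class_CS Cpsi) (class_C_pd _ (CG k)).
        by move=> z [_ [_]]; apply.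
      + move=> z V'z; have [_ _ g0 _] := V'P z V'z.
        have C0 f : class_C 0 U f -> class_C 0 V' (subst j psi f).
          exact: class_C_subst (class_CS C1).
        apply: continuousN; apply: continuousM.
          exact: class_C_continuous (C0 _ (class_C_pd j (CF c))) V'z.
        apply: continuousV => //.
        exact: class_C_continuous (C0 _ (class_C_le (leq0n r) (class_C_pd j (CG k)))) V'z.
      + move=> z V'z; have [Uz _ g0 Dpsi] := V'P z V'z.
        rewrite -[LHS]/(pd l (subst j psi (fun x => F x 0 c)) z).
        rewrite (pd_subst oU oV' V'U _ C1 (CF c) V'z) Dpsi {1}/subst DF// add0r.
        by rewrite mulrN mulNr /subst mulrA mulrAC.
    (* As j lies outside T, the complement loses an element and the bound by m becomes strict. *)
    - by move: Tm; rewrite (card_lift _ j)/= Tj.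
    - by apply: leq_trans Tr; rewrite [leqRHS](card_lift _ j) leq_addl.
  apply: lebesgue_null_sub => _ [x [[Ex dG] Vx] <-].
  have [V'x xE] := VP _ Vx (GE _ _ Ex); exists (col' j x); last by rewrite -xE.
  by split=> //; rewrite -xE.
move=> [Ex0 nE0]; have Ux0 := EU _ Ex0.
have [k [j Tj gj]] : exists k, exists2 j, T j & pd j (G k) x0 != 0.
  apply: contrapT => nk; apply: nE0; split=> // k l Tl.
  by apply/eqP; apply: contrapT => /negP gl; apply: nk; exists k, l.
have [V [V' [psi [Vx0 oV' Cpsi V'P VP]]]] := implicit_function oU Ux0 (CG k) (GE _ _ Ex0) gj.
exists V => //.
have V'U z : V' z -> U (ins j z (psi z)) by move=> /V'P[].
have C1 := class_C_le (ltn0Sn r) Cpsi.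
pose E' := [set z | V' z /\ E (ins j z (psi z))].
have : lebesgue_null ((fun z => F (ins j z (psi z))) @` E').
  apply: (IH V' E' [pred l | T (lift j l)] (fun k => subst j psi (G k))) => //.
  - by move=> z [].
  - by move=> k'; exact: (class_C_subst oU oV' V'U Cpsi (CG k')).
  - by move=> k' z [_ Ez]; exact: GE.
  - by move=> c; exact: (class_C_subst oU oV' V'U C1 (CF c)).
  - move=> c l z V'z Tl.
    rewrite -[LHS]/(pd l (subst j psi (fun x => F x 0 c)) z).
    have Uz := V'U _ V'z.
    by rewrite (pd_subst oU oV' V'U _ C1 (CF c) V'z) /subst !DF// mul0r addr0.
  - move=> z [V'z Ez]; have [lam [lamT [l Tl laml]]] := H _ Ez; exists lam.
    (* The contributions of [psi] add up to a multiple of the combination along j, which vanishes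
       because j is in T; hence the same multipliers work. *)
    have S l' : \sum_k0 lam k0 * pd l' (subst j psi (G k0)) z =
        \sum_k0 lam k0 * pd (lift j l') (G k0) (ins j z (psi z)).
      under eq_bigr do rewrite (pd_subst oU oV' V'U _ Cpsi (CG _) V'z) mulrDr mulrA.
      by rewrite big_split/= -mulr_suml (lamT j Tj) mul0r addr0.
    split; first by move=> l' Tl'; rewrite S lamT.
    case: (unliftP j l) Tl laml => [l' ->|->] Tl laml; last by rewrite Tj in Tl.
    by exists l' => //; rewrite S.
  - by move: Tm; rewrite (card_lift _ j)/= Tj.
  - by apply: leq_trans Tr; rewrite [leqRHS](card_lift _ j) leq_addl.
apply: lebesgue_null_sub => _ [x [[Ex _] Vx] <-].
have [V'x xE] := VP _ Vx (GE _ _ Ex); exists (col' j x); last by rewrite -xE.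
by split=> //; rewrite -xE.
Qed.

(** * The power flow equations *)

Section smooth.
Variables (R : realType) (n : nat).
Implicit Types (phi : R -> R) (x : 'rV[R]_n).

Lemma differentiable_comp_coord phi j x : derivable phi (x 0 j) 1 ->
  differentiable (fun x => phi (x 0 j)) x.
Proof.
move=> dphi; apply: (@differentiable_comp _ _ _ _ (fun x : 'rV[R]_n => x 0 j)).
  exact: differentiable_coord.
exact/derivable1_diffP.
Qed.

Lemma pd_coord (i j : 'I_n) x : pd i (fun x => x 0 j) x = (j == i)%:R.
Proof. by rewrite /pd (derive_row (H := id)) ?derive_id// mxE eqxx. Qed.

Lemma pd_comp_coord phi i j x : derivable phi (x 0 j) 1 ->
  pd i (fun x => phi (x 0 j)) x = (j == i)%:R * 'D_1 phi (x 0 j).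
Proof.
move=> dphi; rewrite /pd deriveE; last exact: differentiable_comp_coord.
have dc : differentiable (fun x : 'rV[R]_n => x 0 j) x by exact: differentiable_coord.
have dphi' : differentiable phi (x 0 j) by exact/derivable1_diffP.
rewrite (@diff_comp _ _ _ _ (fun x : 'rV[R]_n => x 0 j) phi x)//=.
by rewrite diff1E// -deriveE// -(pd_coord i j x) derive1E.
Qed.

(** Each function is, up to sign, the derivative of the other, so both are treated in one
    induction. *)
Lemma class_C_trigo k (U : set 'rV[R]_n) j : open U ->
  class_C k U (fun x => cos (x 0 j)) /\ class_C k U (fun x => sin (x 0 j)).
Proof.
move=> oU.
have dcos y : derivable (@cos R) y 1 by exact: derivable_cos.
have dsin y : derivable (@sin R) y 1 by exact: derivable_sin.
have dc x := differentiable_comp_coord (j := j) (x := x) (dcos (x 0 j)).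
have ds x := differentiable_comp_coord (j := j) (x := x) (dsin (x 0 j)).
have cc x := differentiable_continuous (dc x).
have cs x := differentiable_continuous (ds x).
elim: k => [|k [IHc IHs]]; first by split; split.
split; split=> // i; split; first by move=> x _; exact: diff_derivable.
- have := class_CM oU (class_C_cst k U (j == i)%:R) (class_CN oU IHs).
  apply: class_C_ext => // x Ux.
  rewrite -[RHS]/(pd i (fun x => cos (x 0 j)) x) pd_comp_coord//.
  by rewrite derive_val.
- by move=> x _; exact: diff_derivable.
- have := class_CM oU (class_C_cst k U (j == i)%:R) IHc.
  apply: class_C_ext => // x Ux.
  rewrite -[RHS]/(pd i (fun x => sin (x 0 j)) x) pd_comp_coord//.
  by rewrite derive_val.
Qed.

Definition class_C_complex k (U : set 'rV[R]_n) (f : 'rV[R]_n -> R[i]) :=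
  class_C k U (fun x => complex.Re (f x)) /\ class_C k U (fun x => complex.Im (f x)).

Lemma class_C_complex_cst k U c : class_C_complex k U (fun=> c).
Proof. by split; exact: class_C_cst. Qed.

Lemma class_C_complexM k U f g : open U -> class_C_complex k U f ->
  class_C_complex k U g -> class_C_complex k U (fun x => f x * g x).
Proof.
move=> oU [f1 f2] [g1 g2]; split.
  have := class_CD oU (class_CM oU f1 g1) (class_CN oU (class_CM oU f2 g2)).
  by apply: class_C_ext => // x _; case: (f x) (g x) => [a b] [c d].
have := class_CD oU (class_CM oU f1 g2) (class_CM oU f2 g1).
by apply: class_C_ext => // x _; case: (f x) (g x) => [a b] [c d].
Qed.

Lemma class_C_complex_conj k U f : open U -> class_C_complex k U f ->
  class_C_complex k U (fun x => conjc (f x)).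
Proof.
move=> oU [f1 f2]; split; first by apply: class_C_ext f1 => // x _; case: (f x).
by apply: class_C_ext (class_CN oU f2) => // x _; case: (f x).
Qed.

Lemma class_C_complex_sum k U (I : Type) (s : seq I) (F : I -> 'rV[R]_n -> R[i]) :
  open U -> (forall i, class_C_complex k U (F i)) ->
  class_C_complex k U (fun x => \sum_(i <- s) F i x).
Proof.
move=> oU CF; split.
  apply: (@class_C_ext _ _ k U (fun x => \sum_(i <- s) complex.Re (F i x))) => //.
    by move=> x _; rewrite raddf_sum.
  by apply: class_C_sum => // i; have [] := CF i.
apply: (@class_C_ext _ _ k U (fun x => \sum_(i <- s) complex.Im (F i x))) => //.
  by move=> x _; rewrite raddf_sum.
by apply: class_C_sum => // i; have [] := CF i.
Qed.

End smooth.

(** * Power injections and load coordinates *)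

Section power.
Variables (R : realType) (N : nat) (net : power_network R N).
Implicit Types (x z : state R N) (xi : load R N).

Lemma class_C_voltage k (U : set 'rV[R]_((N + N) + (N + N))) i : open U ->
  class_C_complex k U (fun x => voltage x i 0).
Proof.
move=> oU.
rewrite (_ : (fun x => _) = fun x => Complex (v_mag x 0 i) 0 *
  Complex (cos (v_ang x 0 i)) (sin (v_ang x 0 i))); last first.
  by apply/funext => x; rewrite mxE.
apply: class_C_complexM => //; split=> /=.
- rewrite (_ : (fun x => _) = fun x : state R N => x 0 (rshift _ (lshift _ i))).
    exact: class_C_coord.
  by apply/funext => x; rewrite !mxE.
- exact: class_C_cst.
- rewrite (_ : (fun x => _) = fun x : state R N => cos (x 0 (rshift _ (rshift _ i)))).
    by have [] := class_C_trigo k (rshift _ (rshift _ i)) oU.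
  by apply/funext => x; rewrite !mxE.
- rewrite (_ : (fun x => _) = fun x : state R N => sin (x 0 (rshift _ (rshift _ i)))).
    by have [] := class_C_trigo k (rshift _ (rshift _ i)) oU.
  by apply/funext => x; rewrite !mxE.
Qed.

Lemma class_C_power k (U : set 'rV[R]_((N + N) + (N + N))) i : open U ->
  class_C_complex k U (fun x => power net x i 0).
Proof.
move=> oU.
rewrite (_ : (fun x => _) = fun x => voltage x i 0 *
  conjc (\sum_l admittance net i l * voltage x l 0)); last first.
  by apply/funext => x; rewrite /power mul_diag_mx !mxE.
apply: class_C_complexM => //; first exact: class_C_voltage.
apply: class_C_complex_conj => //; apply: class_C_complex_sum => // l.
apply: class_C_complexM => //; first exact: class_C_complex_cst.
exact: class_C_voltage.
Qed.

(** Active and reactive powers drawn by the network at the nodes, as one real vector; it depends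
    only on the voltages and angles. *)
Definition injection x : 'rV[R]_(N + N) :=
  row_mx (map_mx (@complex.Re R) (power net x))^T (map_mx (@complex.Im R) (power net x))^T.

Lemma class_C_injection k (U : set 'rV[R]_((N + N) + (N + N))) i : open U ->
  class_C k U (fun x => injection x 0 i).
Proof.
move=> oU; case: (splitP i) => l il.
  rewrite (_ : (fun x => _) = fun x => complex.Re (power net x l 0)).
    by have [] := class_C_power k l oU.
  apply/funext => x; rewrite (_ : i = lshift N l); last exact: val_inj.
  by rewrite row_mxEl !mxE.
rewrite (_ : (fun x => _) = fun x => complex.Im (power net x l 0)).
  by have [] := class_C_power k l oU.
apply/funext => x; rewrite (_ : i = rshift N l); last exact: val_inj.
by rewrite row_mxEr !mxE.
Qed.

Lemma injection_ext x z : rsubmx x = rsubmx z -> injection x = injection z.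
Proof. by move=> E; rewrite /injection /power /voltage /v_mag /v_ang E. Qed.

Lemma power_flowE xi x : power_flow net xi x = lsubmx x - xi - injection x.
Proof.
rewrite -{2}[xi]hsubmxK -[lsubmx x]hsubmxK /power_flow /injection.
by rewrite !opp_row_mx !add_row_mx.
Qed.

(* The state with loads, voltages and angles given by z that satisfies the power
   flow equations. *)
Definition balanced z : state R N := row_mx (lsubmx z + injection z) (rsubmx z).

Lemma rsubmx_balanced z : rsubmx (balanced z) = rsubmx z.
Proof. by rewrite /balanced row_mxKr. Qed.

Lemma power_flow_balanced xi z : power_flow net xi (balanced z) = lsubmx z - xi.
Proof.
rewrite power_flowE (injection_ext (rsubmx_balanced z)) /balanced row_mxKl.
by rewrite addrAC addrK.
Qed.

Lemma balanced_surj xi x : power_flow net xi x = 0 ->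
  balanced (row_mx xi (rsubmx x)) = x.
Proof.
rewrite power_flowE => /eqP; rewrite subr_eq0 => /eqP E.
rewrite /balanced row_mxKl row_mxKr (injection_ext (z := x)) ?row_mxKr//.
by rewrite -E addrC subrK hsubmxK.
Qed.

Lemma class_C_balanced k (U : set 'rV[R]_((N + N) + (N + N))) i : open U ->
  class_C k U (fun z => balanced z 0 i).
Proof.
move=> oU; case: (splitP i) => l il.
  rewrite (_ : (fun z => _) = fun z => z 0 (lshift _ l) + injection z 0 l).
    by apply: class_CD => //; [exact: class_C_coord|exact: class_C_injection].
  apply/funext => z; rewrite (_ : i = lshift _ l); last exact: val_inj.
  by rewrite row_mxEl !mxE.
rewrite (_ : (fun z => _) = fun z => z 0 (rshift _ l)); first exact: class_C_coord.
apply/funext => x; rewrite (_ : i = rshift _ l); last exact: val_inj.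
by rewrite row_mxEr !mxE.
Qed.

End power.

Lemma jac_entry (R : realType) n m (F : 'rV[R]_n -> 'rV[R]_m) x i l :
  (forall i, differentiable (fun x => F x 0 i) x) ->
  jac F x i l = pd l (fun x => F x 0 i) x.
Proof.
move=> dFi; have dF := differentiable_row dFi.
by rewrite !mxE -deriveE// /pd derive_row.
Qed.

(** * Multipliers where LICQ fails *)

Section multipliers.
Variables (R : realType) (N I J : nat) (P : acopf R N I J).
Implicit Types (x z : state R N) (xi : load R N).

(** The set A is a parameter, not the active set at x, so that each constraint is a fixed function
    that can be differentiated. The index follows the rows of [operational_jac]. *)
Definition constraint (A : {set 'I_J}) (k : 'I_(I + #|A|)) x : R :=
  match fintype.split k with
  | inl i => eqcon P x 0 i
  | inr j => ineqcon P x 0 (enum_val j)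
  end.

Lemma operational_jac_entry x k l :
  (forall i, differentiable (fun x => eqcon P x 0 i) x) ->
  (forall j, differentiable (fun x => ineqcon P x 0 j) x) ->
  operational_jac P x k l = pd l (constraint k) x.
Proof.
move=> dh dg; rewrite mxE /constraint; case: (fintype.split k) => i.
  exact: jac_entry.
have E : (fun x0 => ineqcon_sub P (active P x) x0 0 i) = fun x0 => ineqcon P x0 0 (enum_val i).
  by apply/funext => y; rewrite mxE.
rewrite jac_entry ?E// => j.
rewrite (_ : (fun x0 => _) = fun x0 => ineqcon P x0 0 (enum_val j)) //.
by apply/funext => y; rewrite mxE.
Qed.

Lemma differentiable_balanced z i : differentiable (fun z => balanced (net P) z 0 i) z.
Proof.
have := @class_C_balanced _ _ (net P) 1 setT i openT.
by move=> /class_C_differentiable; apply=> //; exact: openT.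
Qed.

Lemma differentiable_power_flow xi x c : differentiable (fun x => power_flow (net P) xi x 0 c) x.
Proof.
have C1 : class_C 1 setT (fun x : state R N => x 0 (lshift _ c) - xi 0 c - injection (net P) x 0 c).
  apply: class_CD; [exact: openT| |apply: class_CN; first exact: openT].
    by apply: class_CD; [exact: openT|exact: class_C_coord|exact: class_C_cst].
  exact: (class_C_injection _ _ _ openT).
rewrite (_ : (fun x => _) = fun x : state R N => x 0 (lshift _ c) - xi 0 c - injection (net P) x 0 c).
  by apply: class_C_differentiable C1 _ => //; exact: openT.
by apply/funext => y; rewrite power_flowE !mxE.
Qed.

(** A linear relation (mu, lam) between the rows is pulled back along [balanced], where the power
    flow equations have the identity as derivative along the loads and zero along (v, theta). So the
    combination by lam has gradient -mu along the loads and zero along (v, theta). *)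
Lemma not_LICQ_multipliers xi z :
  let x := balanced (net P) z in
  (forall i, differentiable (fun x => eqcon P x 0 i) x) ->
  (forall j, differentiable (fun x => ineqcon P x 0 j) x) ->
  \rank (operational_jac P x) = (I + #|active P x|)%N -> ~ LICQ P xi x ->
  exists lam : 'I_(I + #|active P x|) -> R,
    (forall l, \sum_k lam k * pd (rshift _ l) (constraint k \o balanced (net P)) z = 0) /\
    exists l, \sum_k lam k * pd (lshift _ l) (constraint k \o balanced (net P)) z != 0.
Proof.
move=> x dh dg rk nL.
set M := col_mx (jac (power_flow (net P) xi) x) (operational_jac P x).
have : ~~ row_free M.
  by apply/negP => /eqP; rewrite -/M => rM; apply: nL; rewrite /LICQ -/M rM mul2n addnn addnA.
rewrite -kermx_eq0 => /rowV0Pn[v /sub_kermxP vM v0].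
rewrite -[v]hsubmxK mul_row_col in vM.
set mu := lsubmx v in vM; set lam := rsubmx v in vM.
(* The rows of the operational Jacobian are independent, so a nontrivial relation must involve the
   power flow rows. *)
have mu0 : mu != 0.
  apply/eqP => mu0; move: vM; rewrite mu0 mul0mx add0r => lamM.
  have lam0 : lam = 0.
    have rf : row_free (operational_jac P x) by rewrite /row_free rk.
    by apply: (row_free_inj rf); rewrite lamM mul0mx.
  by move/eqP: v0; apply; rewrite -[v]hsubmxK -/mu -/lam mu0 lam0 row_mx0.
have dk k : differentiable (constraint k) x.
  by rewrite /constraint; case: (fintype.split k) => ?; [exact: dh|exact: dg].
have S l : \sum_k lam 0 k * pd l (constraint k \o balanced (net P)) z =
    - \sum_c mu 0 c * pd l ((fun x => power_flow (net P) xi x 0 c) \o balanced (net P)) z.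
  have ex (p : nat) (a : 'I_p -> R) (g : 'I_p -> state R N -> R) :
      (forall k, differentiable (g k) x) ->
      \sum_k a k * pd l (g k \o balanced (net P)) z =
      \sum_i (\sum_k a k * pd i (g k) x) * pd l (fun z => balanced (net P) z 0 i) z.
    move=> dgk.
    rewrite (eq_bigr (fun k => \sum_i a k * (pd i (g k) x * pd l (fun z => balanced (net P) z 0 i) z))); last first.
      move=> k _; rewrite -mulr_sumr; congr (_ * _).
      apply: pd_comp; [by move=> i; exact: differentiable_balanced|exact: dgk].
    rewrite exchange_big/=; apply: eq_bigr => i _.
    by rewrite mulr_suml; apply: eq_bigr => k _; rewrite mulrA.
  rewrite (ex _ (fun k => lam 0 k) (fun k => constraint k) (dk _)).
  rewrite (ex _ (fun c => mu 0 c) (fun c x => power_flow (net P) xi x 0 c)); last first.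
    by move=> c; exact: differentiable_power_flow.
  rewrite -sumrN; apply: eq_bigr => i _; rewrite -mulNr; congr (_ * _).
  have := congr1 (fun w : 'rV_((N + N) + (N + N)) => w 0 i) vM; rewrite !mxE.
  move/eqP; rewrite addrC addr_eq0 => /eqP E.
  rewrite (eq_bigr (fun k => lam 0 k * operational_jac P x k i)); last first.
    by move=> k _; rewrite operational_jac_entry.
  rewrite E; congr (- _); apply: eq_bigr => c _; rewrite jac_entry// => c'.
  exact: differentiable_power_flow.
have D c l : pd l ((fun x => power_flow (net P) xi x 0 c) \o balanced (net P)) z =
    (lshift (N + N) c == l)%:R.
  rewrite -(pd_coord l (lshift (N + N) c) z) (_ : _ \o _ = fun z => z 0 (lshift (N + N) c) - xi 0 c).
    rewrite /pd deriveB ?derive_cst ?subr0//.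
    by apply: diff_derivable; exact: differentiable_coord.
  by apply/funext => y; rewrite /= power_flow_balanced !mxE.
exists (fun k => lam 0 k); split.
  move=> l; rewrite S big1 ?oppr0// => c _.
  by rewrite D eq_lrshift mulr0.
have [c muc] : exists c, mu 0 c != 0 by case/rV0Pn: mu0 => c; exists c.
exists c; rewrite S oppr_eq0 (bigD1 c)//= big1 ?addr0 => [|c' c'c].
  by rewrite D eqxx mulr1.
by rewrite D eq_shift (negPf c'c) mulr0.
Qed.

End multipliers.

(** * Negligibility of the bad loads *)

Unset Implicit Arguments.

Theorem proposition1 (R : realType) (N I J r : nat) (P : acopf R N I J)
    (Xi : set (load R N))
    (Xi_neq0 : Xi !=set0) (Xi_open : open (Xi : set 'rV[R]_(N + N)))
    (cost_C1 : class_C 1 [set: state R N] (cost P))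
    (r_gt : (2 * N < r)%N)
    (eqcon_Cr : class_C_at r (operational P) (eqcon P))
    (ineqcon_Cr : class_C_at r (operational P) (ineqcon P))
    (operational_rank : forall x, operational P x ->
       \rank (operational_jac P x) = (I + #|active P x|)%N) :
  almost_every Xi (fun xi => forall x, feasible P xi x -> LICQ P xi x).
Proof.
have [Uh [oUh XUh Ch]] := eqcon_Cr; have [Ug [oUg XUg Cg]] := ineqcon_Cr.
pose Th := balanced (net P).
(* Fixing the active set fixes the list of constraints; there are finitely many choices. *)
pose E A : set (state R N) := [set z | [/\ operational P (Th z), active P (Th z) = A &
  ~ LICQ P (lsubmx z) (Th z)]].
apply: (@lebesgue_null_sub _ _ _ (\bigcup_(A : {set 'I_J}) (lsubmx @` E A))).
  move=> xi [_ nL].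
  have [x [fx nLx]] : exists x, feasible P xi x /\ ~ LICQ P xi x.
    apply: contrapT => nx; apply: nL => x fx; apply: contrapT => nLx.
    by apply: nx; exists x.
  have [pf hx gx] := fx.
  exists (active P x) => //; exists (row_mx xi (rsubmx x)); last by rewrite row_mxKl.
  have Tx : Th (row_mx xi (rsubmx x)) = x by exact: balanced_surj.
  by split; rewrite Tx ?row_mxKl.
apply: lebesgue_null_countable => A.
(* With r replaced by its successor, the hypothesis says that the dimension 2N of (v, theta) is at
   most r; the extra derivative is spent on passing to the gradients of the constraints. *)
case: r r_gt Ch Cg {eqcon_Cr ineqcon_Cr} => // r r_gt Ch Cg.
pose U := Th @^-1` (Uh `&` Ug).
have cTh z : {for z, continuous Th}.
  by apply: differentiable_continuous; apply: differentiable_row => i; exact: differentiable_balanced.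
have oU : open U by apply: open_comp; [move=> z _; exact: cTh|exact: openI].
(* T selects the last 2N coordinates (v, theta); its complement consists of the 2N loads, exactly
   the dimension of the target. *)
pose T (l : 'I_((N + N) + (N + N))) := (N + N <= l)%N.
have Ts l : T (rshift _ l) by rewrite /T /= leq_addr.
have Tl l : T (lshift _ l) = false by rewrite /T /= leqNgt ltn_ord.
have Fc c : (fun z : state R N => lsubmx z 0 c) = fun z => z 0 (lshift _ c).
  by apply/funext => z; rewrite mxE.
apply: (@null_critical_parameters _ _ _ _ r U (E A) T (fun k => @constraint _ _ _ _ P A k \o Th)) => //.
- by move=> z [oz _ _]; split; [exact: XUh|exact: XUg].
- move=> k; apply: (class_C_comp (W := Uh `&` Ug)) => //; first exact: openI.
    by move=> i; exact: class_C_balanced.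
  rewrite /constraint; case: (fintype.split k) => i.
    by apply: class_C_sub (Ch i) => x [].
  by apply: class_C_sub (Cg (enum_val i)) => x [].
- move=> k z [[hz gz] eA _]; rewrite /constraint /=; case: (fintype.split k) => i.
    by rewrite hz mxE.
  have : enum_val i \in active P (Th z) by rewrite eA enum_valP.
  by rewrite inE => /eqP.
- by move=> c; rewrite Fc; exact: class_C_coord.
- move=> c l z Uz Tl'; rewrite Fc pd_coord; case: eqP => // lc.
  by rewrite -lc Tl in Tl'.
- move=> z [oz eA nL].
  have dh i : differentiable (fun x => eqcon P x 0 i) (Th z).
    by apply: class_C_differentiable (Ch i) _ => //; exact: XUh.
  have dg j : differentiable (fun x => ineqcon P x 0 j) (Th z).
    by apply: class_C_differentiable (Cg j) _ => //; exact: XUg.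
  have := not_LICQ_multipliers dh dg (operational_rank _ oz) nL.
  rewrite -/Th eA => -[lam [lamT [l laml]]]; exists lam; split.
    move=> l' Tl'; case: (splitP l') => l'' ll.
      by move: Tl'; rewrite /T ll leqNgt ltn_ord.
    by rewrite (_ : l' = rshift _ l'') ?lamT//; exact: val_inj.
  by exists (lshift _ l); rewrite ?Tl.
- rewrite -sum1_card big_mkcond big_split_ord/= (eq_bigr (fun=> 1%N)) => [|l _]; last first.
    by rewrite inE /= Tl.
  rewrite sum1_card card_ord big1 ?addn0// => l _.
  by rewrite inE /= Ts.
- rewrite -sum1_card big_mkcond big_split_ord/= big1 => [|l _]; last first.
    by rewrite -topredE /= Tl.
  rewrite add0n (eq_bigr (fun=> 1%N)) => [|l _]; last by rewrite -topredE /= Ts.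
  by rewrite sum1_card card_ord addnn -mul2n -ltnS.
Qed.
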